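(* We have $\sigma(\phi)=0$ if and only if $\alpha$ is of class $C^{1+\epsilon}$.
   Context: Identify $\mathbb{S}^1$ with $\mathbb{R}/\mathbb{Z}$ via $t\mapsto(\cos 2\pi t,\sin 2\pi t)$; functions on $\mathbb{S}^1$ are identified with $1$-periodic functions on $\mathbb{R}$. Fix $\epsilon\in(0,1)$; $C^{k+\epsilon}$ means $C^k$ with $\epsilon$-Hölder $k$-th derivative. Let $f:\mathbb{S}^1\to\mathbb{S}^1$ be a $C^{2+\epsilon}$ expanding map, i.e. there is $\lambda>1$ with $|Df(x)|>\lambda$ for every $x$, and let $v:\mathbb{S}^1\to\mathbb{R}$ be a $C^{1+\epsilon}$ function. The generalized Weierstrass function $\alpha:\mathbb{S}^1\to\mathbb{R}$ is $$\alpha(y)=-\sum_{n=1}^{\infty}\frac{v(f^{n-1}(y))}{Df^n(y)},$$ where $f^n$ is the $n$-th iterate of $f$; it is the unique bounded solution of $v(x)=\alpha(f(x))-Df(x)\alpha(x)$. Let $$\phi(x)=-\left(\frac{v'(x)+\alpha(x)D^2f(x)}{Df(x)}\right),$$ let $\mu$ be the unique $f$-invariant Borel probability absolutely continuous with respect to Lebesgue measure, and let $\sigma(\phi)\ge 0$ be given by $$\sigma^2(\phi)=\lim_{n\to\infty}\int\left(\frac{\sum_{j=0}^{n}\phi\circ f^j}{\sqrt n}\right)^2 d\mu.$$ *)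

(* Defs.v *)
From HB Require Import structures.
From mathcomp Require Export all_boot all_order all_algebra.
From mathcomp Require Export all_classical all_reals all_analysis.

Set Implicit Arguments.
Unset Strict Implicit.
Unset Printing Implicit Defensive.

Export Order.TTheory GRing.Theory Num.Theory.
Export numFieldNormedType.Exports.

Local Open Scope classical_set_scope.
Local Open Scope ring_scope.

(* The circle is R / Z: a real function on it is a 1-periodic function on R,
   and a continuous self-map of it is given by a lift F : R -> R, which
   satisfies F (x + 1) = F x + d with d : int the degree.  The derivatives of
   the map are those of F, and iter n F is a lift of its n-th iterate. *)
Definition circle_lift (R : realType) (F : R -> R) : Prop :=
  exists d : int, forall x, F (x + 1) = F x + d%:~R.

Definition holder_continuous (R : realType) (eps : R) (g : R -> R) : Prop :=
  exists C : R, forall x y, `|g x - g y| <= C * `|x - y| `^ eps.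

(* For a 1-periodic k-th derivative, the Hoelder condition with respect to
   |x - y| on R amounts to the one with respect to the distance of R / Z. *)
Definition class_C_holder (R : realType) (k : nat) (eps : R) (g : R -> R)
    : Prop :=
  [/\ forall (j : nat) (x : R), (j < k)%N -> derivable (derive1n j g) x 1,
      continuous (derive1n k g) &
      holder_continuous eps (derive1n k g)].

Definition expanding (R : realType) (F : R -> R) : Prop :=
  exists2 lambda : R, 1 < lambda & forall x, lambda < `|derive1 F x|.

Definition weierstrass (R : realType) (F v : R -> R) (y : R) : R :=
  - limn (fun N : nat =>
      \sum_(1 <= n < N) v (iter n.-1 F y) / derive1 (iter n F) y).

Definition weierstrass_phi (R : realType) (F v : R -> R) (x : R) : R :=
  - ((derive1 v x + weierstrass F v x * derive1n 2 F x) / derive1 F x).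

(* A Borel probability on R / Z is encoded as a Borel probability on R carried
   by the fundamental domain [0, 1[. *)
Definition on_circle (R : realType)
    (mu : probability (measurableTypeR R) R) : Prop :=
  mu `[0, 1[%classic = 1%E.

(* The Borel sets of R / Z are the 1-periodic Borel sets of R, whose preimages
   by a circle lift are again 1-periodic. *)
Definition circle_invariant (R : realType) (F : R -> R)
    (mu : probability (measurableTypeR R) R) : Prop :=
  forall A : set (measurableTypeR R), measurable A ->
    (forall x, A (x + 1) <-> A x) -> mu (F @^-1` A) = mu A.

(* Extended-real valued, so that a variance diverging to +oo does not collapse
   to a default real value. *)
Definition asymptotic_variance (R : realType) (F phi : R -> R)
    (mu : probability (measurableTypeR R) R) : \bar R :=
  limn (fun n : nat => \int[mu]_x
    (((\sum_(0 <= j < n.+1) phi (iter j F x)) / Num.sqrt n%:R) ^+ 2)%:E)%E.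

Definition sigma (R : realType) (F phi : R -> R)
    (mu : probability (measurableTypeR R) R) : \bar R :=
  sqrte (asymptotic_variance F phi mu).

(* Main.v *)
Require Import Defs.
From mathcomp Require Import ring lra measurable_realfun.

(** The equation alpha o F = v + F' alpha, differentiated formally, reads
    phi = alpha' - alpha' o F.  So if alpha is differentiable with continuous
    derivative, phi is a coboundary, its Birkhoff sums are bounded and the variance
    vanishes (coboundary_zero_variance).  The converse has three steps.

    Statistics.  On the real line the lift F is a diffeomorphism with inverse G, and
    L psi (x) is the sum over i < D of psi (G (x + i)) / |F' (G (x + i))|.  L preserves
    the integral over a period and contracts the cones of positive functions with
    Hoelder logarithm (ncone_split), hence iterates of L on Hoelder functions of mean 0
    decay exponentially (transfer_decay).  This gives a positive Hoelder density rho
    with L rho = rho (invariant_density), solutions of chi - L chi = psi (resolvent),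
    and equidistribution: the integral of k psi o F^n over a period tends to the mean
    of k times that of rho psi.  As Lipschitz functions are dense in L^1, equidistribution
    holds for integrable k (weak_cvg_integrable); with k the Lebesgue density of mu it
    shows that mu has density rho (prob_density).

    From variance to coboundary.  If the mean of rho phi is 0, then phi =
    m + w o F - w with w and m Hoelder and the m o F^j pairwise orthogonal
    (martingale_decomposition).  The asymptotic variance is therefore the mean of
    rho m^2 (variance_cvg).  If it is 0 then m = 0 and phi = u - u o F with u = - w.
    That the mean of rho phi is 0 follows from the partial sums A_n of alpha: A_n' has
    mean 0 and stays at bounded distance from the n-th Birkhoff sum of phi (mean_phi0).

    From coboundary to regularity.  Given phi = u - u o F, the functions A_n' - u are,
    up to an error of order lam^-K, of the form beta_K o F^(n - K) with beta_K fixed.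
    By equidistribution their integrals over an interval become proportional to its
    length, so alpha minus a primitive of u is affine (weierstrass_primitive) and
    alpha' = u + c is Hoelder.

    The exponent has to be found in two rounds, because phi is not known to be
    eps-Hoelder beforehand.  For a small exponent gam the fixed point equation gives that
    alpha is gam-Hoelder (weierstrass_bholder), so the argument applies with gam; it makes
    alpha Lipschitz, hence phi eps-Hoelder, and is then repeated with eps. *)

Set Implicit Arguments.
Unset Strict Implicit.
Unset Printing Implicit Defensive.

Local Open Scope classical_set_scope.
Local Open Scope ring_scope.

(** * Derivatives, primitives and integrals over segments *)

Section calculus.
Context {R : realType}.
Implicit Types (f g P : R -> R) (a b x y : R).

Lemma is_derive_continuous f df : (forall x, is_derive x 1 f (df x)) -> continuous f.
Proof.
move=> h x; apply: differentiable_continuous; apply/derivable1_diffP.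
by have [] := h x.
Qed.

Lemma derive1_is_derive f x : derivable f x 1 -> is_derive x 1 f (derive1 f x).
Proof. by move=> h; rewrite derive1E; exact: derivableP. Qed.

Lemma is_derive_derive1 f x l : is_derive x 1 f l -> derive1 f x = l.
Proof. by move=> h; rewrite derive1E derive_val. Qed.

Lemma mean_value f df a b : (forall x, is_derive x 1 f (df x)) ->
  exists c, f b - f a = df c * (b - a).
Proof.
move=> h; have cf : continuous f by exact: is_derive_continuous h.
case: (leP a b) => ab.
  have [c _ e] := @MVT_segment _ f df a b ab (fun x _ => h x)
    (continuous_subspaceT cf).
  by exists c.
have [c _ e] := @MVT_segment _ f df b a (ltW ab) (fun x _ => h x)
    (continuous_subspaceT cf).
by exists c; rewrite -opprB e -mulrN opprB.
Qed.

Lemma lipschitz_of_derive f df B : (forall x, is_derive x 1 f (df x)) ->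
  (forall x, `|df x| <= B) -> forall x y, `|f x - f y| <= B * `|x - y|.
Proof.
move=> h hB x y; have [c ->] := mean_value y x h.
by rewrite normrM ler_wpM2r.
Qed.

Lemma expanding_of_derive f df B : (forall x, is_derive x 1 f (df x)) ->
  (forall x, B <= `|df x|) -> forall x y, B * `|x - y| <= `|f x - f y|.
Proof.
move=> h hB x y; have [c ->] := mean_value y x h.
by rewrite normrM ler_wpM2r.
Qed.

Lemma derive_eq_cst f g h x y : (forall x, is_derive x 1 f (h x)) ->
  (forall x, is_derive x 1 g (h x)) -> f x - f y = g x - g y.
Proof.
move=> hf hg.
have e : forall x, is_derive x 1 (fun x => f x - g x) 0.
  by move=> z; rewrite -(subrr (h z)); apply: is_deriveB.
by have := @is_derive_0_is_cst R (fun x => f x - g x) x y e => /=; lra.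
Qed.

Lemma continuous_integrable g a b : continuous g ->
  (@lebesgue_measure R).-integrable `[a, b] (EFin \o g).
Proof.
move=> cg; apply: continuous_compact_integrable; first exact: segment_compact.
exact: continuous_subspaceT.
Qed.

Definition segint a b g : R := \int[@lebesgue_measure R]_(t in `[a, b]) g t.

(** The signed integral from 0 is a primitive on the whole line because near any
    point it differs by a constant from the integral based further to the left. *)
Lemma exists_primitive g : continuous g ->
  exists P, forall x, is_derive x 1 P (g x).
Proof.
move=> cg; exists (fun x => segint 0 x g - segint x 0 g) => x0.
(* a base point to the left of both 0 and x0 *)
pose a := - (`|x0| + 1).
have nx := normr_ge0 x0.
have ax0 : a < x0 by rewrite /a; have := lerNnormlW (lexx `|x0|); lra.
have a0 : a < 0 by rewrite /a; lra.
have chasles y z : a < y -> y <= z -> segint a z g - segint a y g = segint y z g.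
  move=> ay yz; rewrite /segint.
  rewrite (@Rintegral_itvB _ g (BLeft a) (BRight z) y); last 3 first.
  - exact: continuous_integrable.
  - by rewrite bnd_simp ltW.
  - by rewrite bnd_simp.
  apply: Rintegral_itv_obnd_cbnd.
  apply: (integrableS _ _ _ (@continuous_integrable g y z cg)) => //.
  by apply: subset_itvr => //; rewrite bnd_simp.
have segxx y z : z < y -> segint y z g = 0.
  by move=> yz; rewrite /segint set_itv_ge ?Rintegral_set0// bnd_simp -ltNge.
have segx y : segint y y g = 0 by rewrite /segint set_itv1 Rintegral_set1.
have E y : a < y -> segint 0 y g - segint y 0 g = segint a y g - segint a 0 g.
  move=> ay; case: (ltgtP y 0) => [y0|y0|->].
  - by rewrite (segxx 0 y)// -(chasles y 0)// ?(ltW y0)//; lra.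
  - by rewrite (segxx y 0)// (chasles 0 y)// ?(ltW y0)//; lra.
  - by rewrite !subrr.
have [dP eP] : derivable (fun y => segint a y g) x0 1 /\
    derive1 (fun y => segint a y g) x0 = g x0.
  apply: (@continuous_FTC1_closed _ g a x0 (x0 + 1)) => //.
  - by rewrite ltrDl.
  - exact: continuous_integrable.
  - exact: cg.
have H1 : is_derive x0 1 (fun y => segint a y g) (g x0).
  by rewrite -eP; exact: derive1_is_derive.
have H2 : is_derive x0 1 (fun y => segint a y g - segint a 0 g) (g x0).
  by rewrite -(subr0 (g x0)); apply: is_deriveB.
apply: (@near_eq_is_derive _ _ _ (fun y => segint a y g - segint a 0 g)) => //.
near=> y; rewrite E//; near: y.
exact: lt_nbhsr.
Unshelve. all: by end_near. Qed.

Lemma segintE g P a b : continuous g -> (forall x, is_derive x 1 P (g x)) ->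
  a <= b -> segint a b g = P b - P a.
Proof.
move=> cg dP; rewrite le_eqVlt => /orP[/eqP->|ab].
  by rewrite /segint set_itv1 Rintegral_set1 subrr.
rewrite /segint /Rintegral (@continuous_FTC2 _ g P)//.
- exact: continuous_subspaceT.
- have cP := is_derive_continuous dP.
  split; first by move=> x _; have [] := dP x.
  + exact/cvg_at_right_filter/cP.
  + exact/cvg_at_left_filter/cP.
- by move=> x _; exact: is_derive_derive1.
Qed.

End calculus.

Section segment_integral.
Context {R : realType}.
Implicit Types (f g : R -> R) (a b c : R).

Lemma segintD a b f g : continuous f -> continuous g ->
  segint a b (fun x => f x + g x) = segint a b f + segint a b g.
Proof. by move=> cf cg; apply: RintegralD => //; exact: continuous_integrable. Qed.

Lemma segintB a b f g : continuous f -> continuous g ->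
  segint a b (fun x => f x - g x) = segint a b f - segint a b g.
Proof. by move=> cf cg; apply: RintegralB => //; exact: continuous_integrable. Qed.

Lemma segintZ a b c f : continuous f ->
  segint a b (fun x => c * f x) = c * segint a b f.
Proof. by move=> cf; apply: RintegralZl => //; exact: continuous_integrable. Qed.

Lemma segint_cst a b c : a <= b -> segint a b (fun _ => c) = c * (b - a).
Proof.
move=> ab; rewrite /segint Rintegral_cst//= lebesgue_measure_itv/= lte_fin.
case: ltP => [//|ba]; have -> : b = a by apply/eqP; rewrite eq_le ab ba.
by rewrite subrr.
Qed.

Lemma le_segint a b f g : continuous f -> continuous g ->
  (forall x, a <= x <= b -> f x <= g x) -> segint a b f <= segint a b g.
Proof.
by move=> cf cg fg; apply: le_Rintegral => //; exact: continuous_integrable.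
Qed.

Lemma segint_norm_le a b f c : continuous f -> a <= b ->
  (forall x, a <= x <= b -> `|f x| <= c) -> `|segint a b f| <= c * (b - a).
Proof.
move=> cf ab h; have cc (k : R) : continuous (fun _ : R => k) by exact: cst_continuous.
rewrite ler_norml; apply/andP; split.
  rewrite -mulNr -segint_cst//; apply: le_segint => // x /h.
  by rewrite ler_norml => /andP[].
by rewrite -segint_cst//; apply: le_segint => // x /h; exact: le_trans (ler_norm _).
Qed.

End segment_integral.

Notation mean g := (segint 0 1 g).

(** * Periodic functions *)

Section periodic_functions.
Context {R : realType}.
Implicit Types (f g : R -> R).

Lemma periodic_nat f (n : nat) x : periodic f 1 -> f (x + n%:R) = f x.
Proof. by move=> h; rewrite periodicn. Qed.

Lemma periodic_int f (z : int) x : periodic f 1 -> f (x + z%:~R) = f x.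
Proof.
move=> h; case: z => n; first exact: periodic_nat.
by rewrite NegzE -[in RHS](subrK n.+1%:R x) periodic_nat// mulrNz.
Qed.

Definition fracpart (x : R) : R := x - (Num.floor x)%:~R.

Lemma fracpart_itv x : 0 <= fracpart x < 1.
Proof.
have := floor_itv x; rewrite /fracpart intrD => /andP[h1 h2].
by apply/andP; split; lra.
Qed.

Lemma periodic_fracpart f x : periodic f 1 -> f (fracpart x) = f x.
Proof. by move=> h; rewrite /fracpart -mulrNz periodic_int. Qed.

Definition bounded_fct f := exists B, forall x, `|f x| <= B.

Lemma periodic_bounded f : continuous f -> periodic f 1 -> bounded_fct f.
Proof.
move=> cf pf.
have cn : continuous (fun x => `|f x|).
  by move=> x; apply: cvg_norm; exact: cf.
have [c _ hc] := @EVT_max R (fun x => `|f x|) 0 1 ler01 (continuous_subspaceT cn).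
exists `|f c| => x; rewrite -(periodic_fracpart x pf); apply: hc.
by have := fracpart_itv x; rewrite in_itv/= => /andP[-> /ltW].
Qed.

Lemma derive_periodic f (df : R -> R) c : (forall x, f (x + 1) = f x + c) ->
  (forall x : R, is_derive x 1 f (df x)) -> periodic df 1.
Proof.
move=> fc hf x.
have h1 : is_derive x 1 (fun x => f (x + 1)) (df (x + 1)).
  rewrite -[X in is_derive _ _ _ X]mulr1.
  apply: (@is_derive1_comp _ f (fun x : R => x + 1)) => //.
  by rewrite -[X in is_derive _ _ _ X]addr0; apply: is_deriveD.
have h2 : is_derive x 1 (fun x => f x + c) (df x).
  by rewrite -[X in is_derive _ _ _ X]addr0; apply: is_deriveD.
have e : (fun x => f (x + 1)) = (fun x => f x + c) by apply/funext.
by rewrite -(is_derive_derive1 h1) -(is_derive_derive1 h2) e.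
Qed.

Lemma primitive_shift f (P : R -> R) x y : periodic f 1 ->
  (forall x : R, is_derive x 1 P (f x)) -> P (x + 1) - P x = P (y + 1) - P y.
Proof.
move=> pf dP; have dP1 (z : R) : is_derive z 1 (fun z => P (z + 1)) (f z).
  rewrite -pf -[X in is_derive _ _ _ X]mulr1.
  apply: (@is_derive1_comp _ P (fun x : R => x + 1)) => //.
  by rewrite -[X in is_derive _ _ _ X]addr0; apply: is_deriveD.
by have := derive_eq_cst x y dP1 dP; lra.
Qed.

(** A primitive of a nonnegative function is nondecreasing; if moreover its
    increment over a period vanishes, it is constant on the whole line.  Working
    with the line instead of [0, 1] avoids a separate argument at the endpoints. *)
Lemma mean_eq0 f : continuous f -> periodic f 1 -> (forall x, 0 <= f x) ->
  mean f = 0 -> forall x, f x = 0.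
Proof.
move=> cf pf f0 I0 x; have [P dP] := exists_primitive cf.
have mono u w : u <= w -> P u <= P w.
  move=> uw; have [c e] := mean_value u w dP.
  by rewrite -subr_ge0 e mulr_ge0// subr_ge0.
have shift u : P (u + 1) = P u.
  have := primitive_shift u 0 pf dP.
  by move: I0; rewrite (segintE cf dP ler01) add0r; lra.
have : is_derive x 1 P 0.
  apply: (@near_eq_is_derive _ _ _ (fun=> P (x - 2^-1))) => //.
  near=> y; apply/eqP; rewrite eq_le; apply/andP; split.
    by apply: mono; apply: ltW; near: y; apply: lt_nbhsr; rewrite gtrBl invr_gt0.
  rewrite -(shift (x - 2^-1)); apply: mono; apply: ltW; near: y; apply: lt_nbhsl.
  by lra.
by move/is_derive_derive1 => <-; rewrite (is_derive_derive1 (dP x)).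
Unshelve. all: by end_near. Qed.

End periodic_functions.

(** * The algebra of bounded Hoelder functions *)

Section hoelder_algebra.
Context {R : realType}.
Variable gam : R.
Hypothesis gam_gt0 : 0 < gam.
Implicit Types (f g : R -> R).

Lemma holder_ge0 f : holder_continuous gam f ->
  exists2 C, 0 <= C & forall x y, `|f x - f y| <= C * `|x - y| `^ gam.
Proof.
move=> [C h]; exists `|C|; first exact: normr_ge0.
move=> x y; apply: le_trans (h x y) _; apply: ler_wpM2r (ler_norm _).
exact: powR_ge0.
Qed.

Lemma holder_cont f : holder_continuous gam f -> continuous f.
Proof.
move=> /holder_ge0[C C0 h] x; apply/cvgrPdist_lt => e e0.
have C1 : 0 < C + 1 by lra.
near=> y; apply: le_lt_trans (h x y) _.
apply: (@le_lt_trans _ _ ((C + 1) * `|x - y| `^ gam)).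
  by rewrite ler_wpM2r ?powR_ge0//; lra.
rewrite mulrC -ltr_pdivlMr//.
have : `|x - y| < (e / (C + 1)) `^ gam^-1.
  by near: y; apply: cvgr_dist_lt => //; apply: powR_gt0; exact: divr_gt0.
move=> /(gt0_ltr_powR gam_gt0); rewrite -powRrM mulVf ?gt_eqF// powRr1 ?divr_ge0 ?ltW//.
by apply; rewrite nnegrE ?powR_ge0.
Unshelve. all: by end_near. Qed.

(** A Hoelder bound on the whole line controls increments at large distances only
    by a power of the distance, so boundedness is required separately: it is what
    makes the class stable under products and decreasing in the exponent. *)
Definition bholder f := bounded_fct f /\ holder_continuous gam f.

Lemma bholder_cst c : bholder (fun _ => c).
Proof. by split; [exists (`|c|) | exists 0 => x y; rewrite subrr normr0 mul0r]. Qed.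

Lemma bholderD f g : bholder f -> bholder g -> bholder (fun x => f x + g x).
Proof.
move=> [[B hB] [C hC]] [[B' hB'] [C' hC']]; split.
  by exists (B + B') => x; apply: le_trans (ler_normD _ _) _; exact: lerD.
exists (C + C') => x y; rewrite mulrDl opprD addrACA.
by apply: le_trans (ler_normD _ _) _; exact: lerD.
Qed.

Lemma bholderN f : bholder f -> bholder (fun x => - f x).
Proof.
move=> [[B hB] [C hC]]; split; first by exists B => x; rewrite normrN.
by exists C => x y; rewrite -opprD normrN.
Qed.

Lemma bholderB f g : bholder f -> bholder g -> bholder (fun x => f x - g x).
Proof. by move=> hf /bholderN; exact: bholderD. Qed.

Lemma bholderM f g : bholder f -> bholder g -> bholder (fun x => f x * g x).
Proof.
move=> [[B hB] [C hC]] [[B' hB'] [C' hC']]; split.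
  by exists (B * B') => x; rewrite normrM; exact: ler_pM.
exists (B * C' + C * B') => x y.
have -> : f x * g x - f y * g y = f x * (g x - g y) + (f x - f y) * g y by ring.
apply: le_trans (ler_normD _ _) _; rewrite !normrM mulrDl; apply: lerD.
  by rewrite -mulrA; exact: ler_pM.
by rewrite mulrAC; exact: ler_pM.
Qed.

Lemma bholderV f c : 0 < c -> (forall x, c <= `|f x|) -> bholder f ->
  bholder (fun x => (f x)^-1).
Proof.
move=> c0 hc [_ [C hC]].
have f0 x : f x != 0 by rewrite -normr_gt0 (lt_le_trans c0).
have iv x : `|(f x)^-1| <= c^-1 by rewrite normfV lef_pV2 ?posrE// (lt_le_trans c0).
split; first by exists c^-1.
exists (C * (c^-1 * c^-1)) => x y.
have -> : (f x)^-1 - (f y)^-1 = - (f x - f y) * ((f x)^-1 * (f y)^-1).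
  by field; rewrite !f0.
rewrite normrM normrN mulrAC; apply: ler_pM => //.
by rewrite normrM; exact: ler_pM.
Qed.

Lemma bholder_comp f g L : bholder f ->
  (forall x y, `|g x - g y| <= L * `|x - y|) -> bholder (f \o g).
Proof.
move=> [[B hB] /holder_ge0[C C0 hC]] hg; split; first by exists B => x /=.
exists (C * `|L| `^ gam) => x y /=; apply: le_trans (hC _ _) _.
rewrite -mulrA ler_wpM2l// -powRM//; apply: ge0_ler_powR; rewrite ?nnegrE ?mulr_ge0 ?(ltW gam_gt0)//.
by apply: le_trans (hg _ _) _; rewrite ler_wpM2r// ler_norm.
Qed.

Lemma powR_ge1 (t : R) : 1 <= t -> 1 <= t `^ gam.
Proof.
move=> t1; have {1}<- : 1 `^ gam = 1 by rewrite powR1.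
by apply: ge0_ler_powR; rewrite ?nnegrE ?(ltW gam_gt0) ?(le_trans _ t1).
Qed.

(** The Lipschitz bound serves at distances at most 1, the sup bound beyond. *)
Lemma bholder_lipschitz f L : gam <= 1 -> bounded_fct f ->
  (forall x y, `|f x - f y| <= L * `|x - y|) -> bholder f.
Proof.
move=> g1 [B hB] hL; split; first by exists B.
exists (`|L| + 2 * B) => x y.
have B0 : 0 <= B by apply: le_trans (hB 0).
have [t1|t1] := leP 1 `|x - y|.
  have t1' := powR_ge1 t1.
  apply: (@le_trans _ _ (2 * B)).
    by apply: le_trans (ler_normB _ _) _; have := hB x; have := hB y; lra.
  have := normr_ge0 L; nra.
have [/eqP|t0] := eqVneq (x - y) 0.
  rewrite subr_eq0 => /eqP ->; rewrite subrr normr0 mulr_ge0 ?powR_ge0//.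
  by have := normr_ge0 L; lra.
have tt : `|x - y| <= `|x - y| `^ gam.
  by apply: ger1_powR => //; rewrite normr_gt0 t0 ltW.
apply: le_trans (hL x y) _; have := normr_ge0 L; have := ler_norm L.
by have := normr_ge0 (x - y); nra.
Qed.

End hoelder_algebra.

Lemma bholder_weaken {R : realType} (gam eps : R) (f : R -> R) :
  0 < gam -> gam <= eps -> bholder eps f -> bholder gam f.
Proof.
move=> g0 ge [[B hB] hol]; split; first by exists B.
have e0 : 0 < eps by exact: lt_le_trans ge.
have [C C0 hC] := holder_ge0 hol.
exists (C + 2 * B) => x y.
have B0 : 0 <= B by apply: le_trans (hB 0).
have [t1|t1] := leP 1 `|x - y|.
  have t1' := powR_ge1 g0 t1.
  apply: (@le_trans _ _ (2 * B)).
    by apply: le_trans (ler_normB _ _) _; have := hB x; have := hB y; lra.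
  by nra.
have [/eqP|t0] := eqVneq (x - y) 0.
  rewrite subr_eq0 => /eqP ->; rewrite subrr normr0 mulr_ge0 ?powR_ge0//; lra.
have tt : `|x - y| `^ eps <= `|x - y| `^ gam.
  by apply: ger_powR => //; rewrite normr_gt0 t0 ltW.
by apply: le_trans (hC x y) _; have := powR_ge0 `|x - y| eps; nra.
Qed.

(** * Geometric rates of convergence *)

Section geometric.
Context {R : realType}.

Lemma geometric_cvg (u : nat -> R) C r : 0 <= r < 1 ->
  (forall n, `|u n.+1 - u n| <= C * r ^+ n) ->
  cvgn u /\ forall n, `|limn u - u n| <= C / (1 - r) * r ^+ n.
Proof.
move=> /andP[r0 r1] h.
have C0 : 0 <= C by have := le_trans (normr_ge0 _) (h 0%N); rewrite expr0 mulr1.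
have C1 : 0 <= C / (1 - r) by rewrite divr_ge0//; lra.
have key n k : `|u (n + k)%N - u n| <= C / (1 - r) * r ^+ n.
  have : `|u (n + k)%N - u n| <= C / (1 - r) * (r ^+ n - r ^+ (n + k)).
    elim: k => [|k IH]; first by rewrite addn0 !subrr normr0 mulr0.
    rewrite addnS; have := h (n + k)%N.
    have -> : u (n + k).+1 - u n = (u (n + k).+1 - u (n + k)%N) + (u (n + k)%N - u n) by ring.
    have -> : C / (1 - r) * (r ^+ n - r ^+ (n + k).+1) =
       C * r ^+ (n + k) + C / (1 - r) * (r ^+ n - r ^+ (n + k)).
      by rewrite exprS; field; lra.
    by move=> h1; apply: le_trans (ler_normD _ _) _; exact: lerD.
  move/le_trans; apply; rewrite ler_wpM2l// gerBl; exact: exprn_ge0.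
have cu : cvgn u.
  apply/cauchy_cvgP/cauchy_exP => /= e e0.
  have : C / (1 - r) * r ^+ n @[n --> \oo] --> C / (1 - r) * 0.
    by apply: cvgMr; apply: cvg_expr; rewrite ger0_norm.
  rewrite mulr0 => /cvgrPdist_lt/(_ _ e0)[N _ hN].
  exists (u N); exists N => // n /= Nn.
  rewrite /ball/= distrC -(subnKC Nn); apply: le_lt_trans (key _ _) _.
  by have := hN N (leqnn _); rewrite /= sub0r normrN => /(le_lt_trans (ler_norm _)).
split=> // n; apply/ler_addgt0Pr => e e0.
have [N _ hN] := (@cvgrPdist_le _ _ _ _ _ u (limn u)).1 cu e e0.
have h1 := hN (n + N)%N (leq_addl _ _).
rewrite [leRHS]addrC -[limn u](subrK (u (n + N)%N)) -addrA.
apply: le_trans (ler_normD _ _) _; apply: lerD => //; exact: key.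
Qed.

Lemma ler_geometricD (z a C r : R) : 0 <= r < 1 ->
  (forall n, z <= a + C * r ^+ n) -> z <= a.
Proof.
move=> /andP[r0 r1] h; apply/ler_addgt0Pr => e e0.
have : C * r ^+ n @[n --> \oo] --> C * 0.
  by apply: cvgMr; apply: cvg_expr; rewrite ger0_norm.
rewrite mulr0 => /cvgrPdist_le/(_ _ e0)[N _ /(_ N (leqnn _))].
rewrite /= sub0r normrN => /(le_trans (ler_norm _)) hN.
by apply: le_trans (h N) _; rewrite lerD2l.
Qed.

Lemma geometric_eq0 (z C r : R) : 0 <= r < 1 ->
  (forall n, `|z| <= C * r ^+ n) -> z = 0.
Proof.
move=> r01 h; apply/eqP; rewrite -normr_le0.
by apply: (ler_geometricD r01) => n; rewrite add0r.
Qed.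

End geometric.

(** * Contraction of the transfer operator *)

(** Convexity of the exponential between 0 and a: the sum of the tangent inequalities at
    t a, taken at the points a and 0 with the weights t and 1 - t. *)
Lemma expR_chord {R : realType} (a t : R) : 0 <= t <= 1 ->
  expR (t * a) <= 1 + t * (expR a - 1).
Proof.
move=> /andP[t0 t1].
have h1 := expR_ge1Dx (a - t * a); have h2 := expR_ge1Dx (- (t * a)).
have e0 := expR_gt0 (t * a).
have e1 : expR a = expR (a - t * a) * expR (t * a) by rewrite -expRD subrK.
have e2 : 1 = expR (- (t * a)) * expR (t * a) by rewrite -expRD addNr expR0.
rewrite e1 {1 2}e2.
set A := expR (a - t * a) in h1 *; set B := expR (- (t * a)) in h2 *.
set T := expR (t * a) in e0 *.
have -> : B * T + t * (A * T - B * T) = (t * A + (1 - t) * B) * T by ring.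
have := mulr_ge0 t0 (_ : 0 <= A - (1 + (a - t * a))); rewrite subr_ge0 => /(_ h1) h3.
have := @mulr_ge0 _ (1 - t) (B - (1 - t * a)); rewrite !subr_ge0 => /(_ t1 h2) h4.
by rewrite ler_peMl ?(ltW e0)//; lra.
Qed.

Section transfer_operator.
Context {R : realType}.
Variables (gam theta K : R) (D : nat) (G q : R -> R).

(** The branches x |-> G (x + i), i < D, are the local inverses of a circle map of
    degree D seen through its lift, and q is the weight of a preimage; for
    q = 1 / |F'| this is the Perron-Frobenius operator of Lebesgue measure. *)
Definition transfer (psi : R -> R) (x : R) : R :=
  \sum_(i < D) q (G (x + i%:R)) * psi (G (x + i%:R)).

Hypothesis gam_gt0 : 0 < gam.
Hypothesis theta_itv : 0 < theta < 1.
Hypothesis K_ge0 : 0 <= K.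
Hypothesis D_gt0 : (0 < D)%N.
Hypothesis G_contract : forall x y, `|G x - G y| <= theta * `|x - y|.
Hypothesis G_per : forall psi : R -> R, periodic psi 1 ->
  forall x, psi (G (x + D%:R)) = psi (G x).
Hypothesis q_per : periodic q 1.
Hypothesis q_cont : continuous q.
Hypothesis q_gt0 : forall x, 0 < q x.
Hypothesis q_dist : forall x y, q x <= expR (K * `|x - y| `^ gam) * q y.
Hypothesis mean_transfer : forall psi : R -> R, continuous psi ->
  periodic psi 1 -> mean (transfer psi) = mean psi.

Implicit Types (psi f g k : R -> R).

Lemma transfer_per psi : periodic psi 1 -> periodic (transfer psi) 1.
Proof.
move=> pp x; rewrite /transfer.
pose h y := q (G y) * psi (G y).
have hD y : h (y + D%:R) = h y by rewrite /h !G_per.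
have := @big_ord_recl R 0 +%R D (fun i : 'I_D.+1 => h (x + i%:R)).
rewrite big_ord_recr/= hD addr0 addrC => /addrI e.
transitivity (\sum_(i < D) h (x + (bump 0 i)%:R)); last by rewrite -e.
by apply: eq_bigr => i _; rewrite /h /bump/= natrD addrA.
Qed.

Lemma G_continuous : continuous G.
Proof.
move=> x; apply/cvgrPdist_lt => e e0; near=> y.
have /andP[t0 t1] := theta_itv.
apply: le_lt_trans (G_contract _ _) _.
apply: (@le_lt_trans _ _ `|x - y|); first by rewrite ler_piMl// ltW.
by near: y; exact: cvgr_dist_lt.
Unshelve. all: by end_near. Qed.

Lemma transfer_cont psi : continuous psi -> continuous (transfer psi).
Proof.
move=> cp; rewrite /transfer.
pose h (i : nat) x := q (G (x + i%:R)) * psi (G (x + i%:R)).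
have ch i : continuous (h i).
  move=> x; have cG : {for x, continuous (fun x : R => G (x + i%:R))}.
    apply: (@continuous_comp _ _ _ (fun x : R => x + i%:R) G); last exact: G_continuous.
    by apply: cvgD; [exact: cvg_id|exact: cvg_cst].
  apply: cvgM.
  - by apply: (@continuous_comp _ _ _ (fun x : R => G (x + i%:R)) q) => //; exact: q_cont.
  - by apply: (@continuous_comp _ _ _ (fun x : R => G (x + i%:R)) psi) => //; exact: cp.
suff key n : continuous (fun x => \sum_(i < n) h i x) by exact: key.
elim: n => [|n IH].
  have -> : (fun x => \sum_(i < 0) h i x) = (fun _ => 0).
    by apply/funext => x; rewrite big_ord0.
  exact: cst_continuous.
have -> : (fun x => \sum_(i < n.+1) h i x) = (fun x => \sum_(i < n) h i x + h n x).
  by apply/funext => x; rewrite big_ord_recr.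
by move=> x; apply: cvgD; [exact: IH|exact: ch].
Qed.

Lemma transferD f g : transfer (fun x => f x + g x) = fun x => transfer f x + transfer g x.
Proof.
by apply/funext => x; rewrite /transfer -big_split; apply: eq_bigr => i _; rewrite mulrDr.
Qed.

Lemma transferZ c f : transfer (fun x => c * f x) = fun x => c * transfer f x.
Proof.
by apply/funext => x; rewrite /transfer mulr_sumr; apply: eq_bigr => i _; rewrite mulrCA.
Qed.

Lemma transferB f g : transfer (fun x => f x - g x) = fun x => transfer f x - transfer g x.
Proof.
have -> : (fun x => f x - g x) = (fun x => f x + (-1) * g x).
  by apply/funext => x; rewrite mulN1r.
by rewrite transferD transferZ; apply/funext => x; rewrite mulN1r.
Qed.

Lemma le_transfer f g x : (forall y, f y <= g y) -> transfer f x <= transfer g x.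
Proof. by move=> fg; apply: ler_sum => i _; rewrite ler_wpM2l// ltW. Qed.

Lemma iter_transfer_per n psi : periodic psi 1 -> periodic (iter n transfer psi) 1.
Proof. by move=> h; elim: n => //= n; exact: transfer_per. Qed.

Lemma iter_transfer_cont n psi : continuous psi -> continuous (iter n transfer psi).
Proof. by move=> h; elim: n => //= n; exact: transfer_cont. Qed.

Lemma iter_transferZ n c f :
  iter n transfer (fun x => c * f x) = fun x => c * iter n transfer f x.
Proof. by elim: n => //= n ->; rewrite transferZ. Qed.

Lemma iter_transferD n f g :
  iter n transfer (fun x => f x + g x) =
  fun x => iter n transfer f x + iter n transfer g x.
Proof. by elim: n => //= n ->; rewrite transferD. Qed.

Lemma iter_transferB n f g :
  iter n transfer (fun x => f x - g x) =
  fun x => iter n transfer f x - iter n transfer g x.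
Proof. by elim: n => //= n ->; rewrite transferB. Qed.

Lemma mean_iter_transfer n psi : continuous psi -> periodic psi 1 ->
  mean (iter n transfer psi) = mean psi.
Proof.
move=> cp pp; elim: n => //= n <-; apply: mean_transfer.
- exact: iter_transfer_cont.
- exact: iter_transfer_per.
Qed.

(** Positive functions whose logarithm is Hoelder with constant a.  On these cones
    the operator contracts, without any compactness or spectral theory. *)
Definition cone a psi := [/\ periodic psi 1, forall x, 0 < psi x &
  forall x y, psi x <= expR (a * `|x - y| `^ gam) * psi y].

Lemma cone_le a psi x y : 0 <= a -> cone a psi -> psi x <= expR a * psi y.
Proof.
move=> a0 [pp p0 h]; rewrite -(periodic_fracpart x pp) -(periodic_fracpart y pp).
apply: le_trans (h _ (fracpart y)) _; rewrite ler_wpM2r ?(ltW (p0 _))// ler_expR.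
rewrite ler_piMr//; have /andP[? ?] := fracpart_itv x; have /andP[? ?] := fracpart_itv y.
rewrite -[leRHS](_ : 1 `^ gam = 1); last by rewrite powR1.
apply: ge0_ler_powR; rewrite ?nnegrE ?(ltW gam_gt0)// ler_norml.
by apply/andP; split; lra.
Qed.

Lemma cone_holder a psi M : 0 <= a -> cone a psi -> (forall x, psi x <= M) ->
  forall x y, `|psi x - psi y| <= M * expR a * `|x - y| `^ gam.
Proof.
move=> a0 [_ p0 h] hM.
have wl x y : psi x - psi y <= M * expR a * `|x - y| `^ gam.
  have := h x y; set t := `|x - y| `^ gam.
  have t0 : 0 <= t by exact: powR_ge0.
  have := p0 x; have := p0 y; have := hM x; have := hM y.
  have e1 : 1 <= expR a by have := expR_ge1Dx a; lra.
  have [t1|t1] := leP t 1.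
    have := expR_chord a (t := t); rewrite t0 t1 => /(_ isT); rewrite mulrC.
    set E := expR (a * t) => hE hy hx py px hxy.
    have : psi x <= (1 + t * (expR a - 1)) * psi y by rewrite (le_trans hxy)// ler_wpM2r// (ltW py).
    move=> hh; apply: (@le_trans _ _ (t * (expR a - 1) * psi y)); first lra.
    apply: (@le_trans _ _ (t * (expR a - 1) * M)).
      by rewrite ler_wpM2l// mulr_ge0//; lra.
    have : 0 <= t * M by rewrite mulr_ge0//; lra.
    by nra.
  move=> hy hx py px _; have : M <= M * expR a by rewrite ler_peMr//; lra.
  have : M * expR a <= M * expR a * t.
    by rewrite ler_peMr ?(ltW t1)// mulr_ge0 ?expR_ge0//; lra.
  by lra.
move=> x y; rewrite ler_norml; apply/andP; split; last exact: wl.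
by have := wl y x; rewrite distrC; lra.
Qed.

Lemma cone_bholder a psi : 0 <= a -> cone a psi -> bholder gam psi.
Proof.
move=> a0 cp; have [_ p0 _] := cp.
have h x := cone_le x 0 a0 cp; split.
  by exists (expR a * psi 0) => x; rewrite ger0_norm ?h// ltW.
by exists (expR a * psi 0 * expR a); exact: cone_holder.
Qed.

Definition ncone a psi := cone a psi /\ mean psi = 1.

Lemma cst_cont (c : R) : continuous (fun _ : R => c).
Proof. exact: cst_continuous. Qed.

Lemma ncone_bounds a psi : 0 <= a -> ncone a psi ->
  forall x, expR (- a) <= psi x <= expR a.
Proof.
move=> a0 [cp m1] x.
have pc : continuous psi by apply: (holder_cont gam_gt0); case: (cone_bholder a0 cp).
have mc c : mean (fun _ : R => c) = c by rewrite segint_cst// subr0 mulr1.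
rewrite expRN; apply/andP; split.
  rewrite -[leLHS]mul1r ler_pdivrMr ?expR_gt0// mulrC -m1 -[leRHS]mc.
  apply: le_segint => //; first exact: cst_cont.
  by move=> y _; exact: cone_le.
rewrite -[leRHS]mulr1 -m1 -segintZ// -[leLHS]mc.
apply: le_segint => //; first exact: cst_cont.
  by move=> y; apply: cvgMr; exact: pc.
by move=> y _; exact: cone_le.
Qed.

Let kappa := theta `^ gam.

Let kappa_itv : 0 < kappa < 1.
Proof.
have /andP[t0 t1] := theta_itv; rewrite /kappa powR_gt0//=.
have {1}<- : 1 `^ gam = 1 by rewrite powR1.
by apply: gt0_ltr_powR; rewrite ?nnegrE ?(ltW t0).
Qed.

(** The inverse branches contract distances by theta, which improves the constant
    a + K of the product q * psi by the factor theta ^ gam. *)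
Lemma transfer_cone a psi : 0 <= a -> cone a psi -> cone (kappa * (a + K)) (transfer psi).
Proof.
move=> a0 [pp p0 h]; split; first exact: transfer_per.
  move=> x; rewrite /transfer (bigD1 (Ordinal D_gt0))//= ltr_wpDr//.
    by apply: sumr_ge0 => i _; rewrite mulr_ge0 ?(ltW (q_gt0 _)) ?(ltW (p0 _)).
  by rewrite mulr_gt0.
move=> x y; rewrite /transfer mulr_sumr; apply: ler_sum => i _.
set u := G _; set w := G _.
have uw : `|u - w| `^ gam <= kappa * `|x - y| `^ gam.
  have /andP[t0 t1] := theta_itv.
  rewrite /kappa -powRM// ?(ltW t0)//; apply: ge0_ler_powR; rewrite ?nnegrE ?(ltW gam_gt0)//.
    by rewrite mulr_ge0// ltW.
  by apply: le_trans (G_contract _ _) _; rewrite opprD addrACA subrr addr0.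
have -> : kappa * (a + K) * `|x - y| `^ gam =
  K * (kappa * `|x - y| `^ gam) + a * (kappa * `|x - y| `^ gam) by ring.
rewrite expRD mulrACA; apply: ler_pM; rewrite ?(ltW (q_gt0 _)) ?(ltW (p0 _))//.
  apply: le_trans (q_dist u w) _.
  by rewrite ler_wpM2r ?(ltW (q_gt0 _))// ler_expR ler_wpM2l.
apply: le_trans (h u w) _.
by rewrite ler_wpM2r ?(ltW (p0 _))// ler_expR ler_wpM2l.
Qed.

(* any a > kappa K / (1 - kappa) is mapped to a smaller constant a' *)
Let a := (kappa * K + 1) / (1 - kappa).
Let a' := kappa * (a + K).

Let a_gt0 : 0 < a.
Proof.
have /andP[k0 k1] := kappa_itv; rewrite /a divr_gt0//; last lra.
by have := mulr_ge0 (ltW k0) K_ge0; lra.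
Qed.

Let a'_itv : 0 < a' < a.
Proof.
have /andP[k0 k1] := kappa_itv; have a0 := a_gt0.
have e : a * (1 - kappa) = kappa * K + 1 by rewrite /a divfK// gt_eqF//; lra.
apply/andP; split; last by rewrite /a'; nra.
by rewrite mulr_gt0// ltr_wpDr.
Qed.

(* exp (- a') bounds normalized elements of the smaller cone from below; the factor
   1 - a' / a pays for the subtraction in ncone_split *)
Let c := expR (- a') * (1 - a' / a).

Let ca_itv : 0 < 1 - a' / a < 1.
Proof.
have /andP[h0 h1] := a'_itv.
have : 0 < a' / a by rewrite divr_gt0.
have : a' / a < 1 by rewrite ltr_pdivrMr// mul1r.
by move=> ? ?; apply/andP; split; lra.
Qed.

Let c_itv : [/\ 0 < c, c < 1 & c < expR (- a')].
Proof.
have /andP[h0 h1] := ca_itv; have e0 := expR_gt0 (- a').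
have /andP[h0' h1'] := a'_itv.
have e1 : expR (- a') <= 1 by rewrite expR_le1; lra.
have ce : c < expR (- a') by rewrite /c gtr_pMr.
by split; [rewrite /c mulr_gt0|exact: lt_le_trans e1|].
Qed.

Let r := 1 - c.

Let r_itv : 0 <= r < 1.
Proof. by have [h1 h2 _] := c_itv; rewrite /r; apply/andP; split; lra. Qed.

(** A normalized element of the smaller cone is bounded below by exp (- a'), so it
    is the sum of the constant c and of (1 - c) times a normalized element of the
    larger cone.  The difference of two such functions is then (1 - c) times a
    difference of normalized elements: this is the source of all exponential
    rates below. *)
Lemma ncone_split psi : ncone a' psi -> ncone a (fun x => r^-1 * (psi x - c)).
Proof.
move=> np; have [[pp p0 h] m1] := np.
have [c0 c1 ce] := c_itv; have /andP[h0' h1'] := a'_itv.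
have r0 : 0 < r by rewrite /r; lra.
have bd x : expR (- a') <= psi x by have /andP[] := ncone_bounds (ltW h0') np x.
have pc : continuous psi.
  by apply: (holder_cont gam_gt0); case: (cone_bholder (ltW h0') np.1).
split; last first.
  rewrite segintZ; last by move=> x; apply: cvgB; [exact: pc|exact: cvg_cst].
  rewrite segintB//; last exact: cst_cont.
  by rewrite m1 segint_cst// subr0 mulr1 mulVf// gt_eqF.
split.
- by move=> x; rewrite pp.
- by move=> x; rewrite mulr_gt0 ?invr_gt0//; have := bd x; lra.
move=> x y; rewrite mulrCA ler_wpM2l ?invr_ge0 ?(ltW r0)//.
set t := `|x - y| `^ gam; have t0 : 0 <= t by exact: powR_ge0.
have hx := h x y; rewrite -/t in hx.
have ratio : 0 <= a' / a <= 1.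
  by have /andP[] := ca_itv => ? ?; apply/andP; split; lra.
have := expR_chord (a * t) ratio.
have -> : a' / a * (a * t) = a' * t by field; rewrite gt_eqF.
have E1 : 1 <= expR (a * t).
  by have := expR_ge1Dx (a * t); have := mulr_ge0 (ltW a_gt0) t0; lra.
move: hx E1; set E := expR (a * t); set E' := expR (a' * t) => hx E1 hE.
have hby := bd y.
have : c * (E - 1) <= (E - E') * psi y.
  apply: (@le_trans _ _ ((E - 1) * (1 - a' / a) * psi y)).
    rewrite -mulrA mulrC /c ler_wpM2l ?subr_ge0// mulrC ler_wpM2l//.
    by have /andP[/ltW] := ca_itv.
  by rewrite ler_wpM2r ?(ltW (p0 y))//; lra.
by lra.
Qed.

Lemma ncone_contract psi1 psi2 : ncone a psi1 -> ncone a psi2 ->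
  exists f g, [/\ ncone a f, ncone a g &
    forall x, transfer psi1 x - transfer psi2 x = r * (f x - g x)].
Proof.
have st psi : ncone a psi -> ncone a (fun x => r^-1 * (transfer psi x - c)).
  move=> [cp m1]; apply: ncone_split; split; first exact: transfer_cone (ltW a_gt0) cp.
  rewrite mean_transfer//; last by case: cp.
  by apply: (holder_cont gam_gt0); case: (cone_bholder (ltW a_gt0) cp).
move=> /st n1 /st n2.
exists (fun x => r^-1 * (transfer psi1 x - c)), (fun x => r^-1 * (transfer psi2 x - c)).
split=> // x; have [_ c1 _] := c_itv.
by rewrite /r; field; lra.
Qed.

Lemma ncone_iter_contract n psi1 psi2 : ncone a psi1 -> ncone a psi2 ->
  exists f g, [/\ ncone a f, ncone a g &
    forall x, iter n transfer psi1 x - iter n transfer psi2 x = r ^+ n * (f x - g x)].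
Proof.
move=> n1 n2; elim: n => [|n [f [g [nf ng e]]]].
  by exists psi1, psi2; split=> // x; rewrite expr0 mul1r.
have [f' [g' [nf' ng' e']]] := ncone_contract nf ng.
exists f', g'; split=> // x /=.
have := congr1 (@^~ x) (transferB (iter n transfer psi1) (iter n transfer psi2)).
move=> /= <-; rewrite (_ : (fun y => _) = (fun x => r ^+ n * (f x - g x))); last exact/funext.
by rewrite transferZ transferB e' exprS; ring.
Qed.

Lemma ncone1 : ncone a (fun _ => 1).
Proof.
split; last by rewrite segint_cst// subr0 mulr1.
split=> // x y; rewrite mulr1.
have := expR_ge1Dx (a * `|x - y| `^ gam).
by have := mulr_ge0 (ltW a_gt0) (powR_ge0 `|x - y| gam); lra.
Qed.

(** A Hoelder function of mean 0, shifted by a large constant k, is k times a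
    normalized element of the cone, and can be compared with the constant 1.
    The bound is in the sup norm and in the Hoelder seminorm at once. *)
Lemma transfer_decay psi : bholder gam psi -> periodic psi 1 -> mean psi = 0 ->
  exists2 M, 0 <= M & forall n,
    (forall x, `|iter n transfer psi x| <= M * r ^+ n) /\
    (forall x y, `|iter n transfer psi x - iter n transfer psi y| <=
       M * r ^+ n * `|x - y| `^ gam).
Proof.
move=> bh pp m0; have [[B hB] /holder_ge0[C C0 hC]] := bh.
have pc : continuous psi by case: bh => _; exact: holder_cont.
have B0 : 0 <= B by apply: le_trans (hB 0).
have a0 := a_gt0; have Ca : 0 <= C / a by rewrite divr_ge0 ?(ltW a0).
(* B makes psi + k positive, C / a makes its logarithm a-Hoelder *)
pose k := B + C / a + 1; have k0 : 0 < k by rewrite /k; lra.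
have n1 : ncone a (fun x => k^-1 * (psi x + k)).
  split; last first.
    rewrite segintZ; last by move=> x; apply: cvgD; [exact: pc|exact: cvg_cst].
    rewrite segintD//; last exact: cst_cont.
    by rewrite m0 add0r segint_cst// subr0 mulr1 mulVf// gt_eqF.
  have lo y : - B <= psi y by have := hB y; rewrite ler_norml => /andP[].
  split.
  - by move=> x; rewrite pp.
  - by move=> x; rewrite mulr_gt0 ?invr_gt0//; have := lo x; rewrite /k; lra.
  move=> x y; rewrite mulrCA ler_wpM2l ?invr_ge0 ?(ltW k0)//.
  set t := `|x - y| `^ gam; have t0 : 0 <= t by exact: powR_ge0.
  have h1 : psi x - psi y <= C * t by apply: le_trans (hC x y); exact: ler_norm.
  have h2 := expR_ge1Dx (a * t).
  have h3 : C * t = a * t * (C / a) by field; rewrite gt_eqF.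
  have h4 : a * t * (C / a) <= (expR (a * t) - 1) * (psi y + k).
    have at0 := mulr_ge0 (ltW a0) t0.
    apply: ler_pM => //; first lra.
    by have := lo y; rewrite /k; lra.
  by lra.
exists (k * (2 * (expR a * expR a))).
  by rewrite mulr_ge0 ?(ltW k0)// mulr_ge0// mulr_ge0 ?expR_ge0.
move=> n; have [f [g [nf ng e]]] := ncone_iter_contract n n1 ncone1.
have E x : iter n transfer psi x = k * (r ^+ n * (f x - g x)).
  rewrite -e; have {1}-> : psi = (fun x => k * (k^-1 * (psi x + k) - 1)).
    by apply/funext => y; field; rewrite gt_eqF.
  by rewrite iter_transferZ iter_transferB.
have rn0 : 0 <= r ^+ n by rewrite exprn_ge0//; case/andP: r_itv.
have ea1 : 1 <= expR a by have := expR_ge1Dx a; lra.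
have bf h : ncone a h -> forall x, `|h x| <= expR a.
  move=> nh x; have /andP[h1 h2] := ncone_bounds (ltW a0) nh x.
  by rewrite ger0_norm// (le_trans _ h1)// expR_ge0.
have hf h : ncone a h -> forall x y, `|h x - h y| <= expR a * expR a * `|x - y| `^ gam.
  move=> nh; apply: cone_holder; [exact: ltW|exact: nh.1|].
  by move=> x; have /andP[] := ncone_bounds (ltW a0) nh x.
split=> [x|x y].
  rewrite E !normrM (ger0_norm (ltW k0)) (ger0_norm rn0).
  rewrite -(mulrA k) ler_wpM2l ?(ltW k0)// mulrC ler_wpM2r//.
  apply: le_trans (ler_normB _ _) _; have := bf f nf x; have := bf g ng x.
  have : expR a <= expR a * expR a by rewrite ler_peMl// expR_ge0.
  by lra.
rewrite !E -!mulrBr !normrM (ger0_norm (ltW k0)) (ger0_norm rn0).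
rewrite -!mulrA ler_wpM2l ?(ltW k0)// [leRHS](_ : _ = r ^+ n *
  (2 * (expR a * expR a * `|x - y| `^ gam))); last by ring.
rewrite ler_wpM2l//.
have -> : f x - g x - (f y - g y) = (f x - f y) - (g x - g y) by ring.
apply: le_trans (ler_normB _ _) _; have := hf f nf x y; have := hf g ng x y.
by lra.
Qed.

Lemma transfer1_bound : exists2 Q, 0 <= Q & forall f e,
  (forall x, `|f x| <= e) -> forall x, `|transfer f x| <= Q * e.
Proof.
have tc1 : continuous (transfer (fun _ => 1)) by apply: transfer_cont; exact: cst_cont.
have p1 : periodic (fun _ : R => 1 : R) 1 by [].
have [Q hQ] := periodic_bounded tc1 (transfer_per p1).
exists Q; first exact: le_trans (hQ 0).
move=> f e he x; have e0 : 0 <= e by exact: le_trans (he 0).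
have le1 : transfer f x <= e * transfer (fun _ => 1) x.
  rewrite -[leRHS](congr1 (@^~ x) (transferZ e (fun _ => 1))); apply: le_transfer => y.
  by rewrite mulr1; apply: le_trans (he y); exact: ler_norm.
have le2 : - e * transfer (fun _ => 1) x <= transfer f x.
  rewrite -[leLHS](congr1 (@^~ x) (transferZ (- e) (fun _ => 1))); apply: le_transfer => y.
  by rewrite mulr1; have := he y; rewrite ler_norml => /andP[].
have := ler_wpM2l e0 (le_trans (ler_norm _) (hQ x)).
by rewrite ler_norml mulrC => h; apply/andP; split; lra.
Qed.

(** The solution is the Neumann series of psi; it converges geometrically by
    transfer_decay, uniformly and for the Hoelder seminorm. *)
Lemma resolvent psi : bholder gam psi -> periodic psi 1 -> mean psi = 0 ->
  exists chi, [/\ bholder gam chi, periodic chi 1, mean chi = 0 &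
    forall x, chi x - transfer chi x = psi x].
Proof.
move=> bh pp m0; have [M M0 hM] := transfer_decay bh pp m0.
have pc : continuous psi by case: bh => _; exact: holder_cont.
have /andP[r0 r1] := r_itv.
pose u n x := \sum_(k < n) iter k transfer psi x.
have uS n x : u n.+1 x = u n x + iter n transfer psi x by rewrite /u big_ord_recr.
have u0 x : u 0%N x = 0 by rewrite /u big_ord0.
have du x n : `|u n.+1 x - u n x| <= M * r ^+ n.
  by rewrite uS addrC addKr; exact: (hM n).1.
have hu x n : `|limn (u^~ x) - u n x| <= M / (1 - r) * r ^+ n.
  by have [_] := @geometric_cvg R (u^~ x) M r r_itv (du x); exact.
pose chi x := limn (u^~ x).
have up n : periodic (u n) 1.
  by move=> x; apply: eq_bigr => k _; exact: iter_transfer_per.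
have uc n : continuous (u n).
  elim: n => [|n IH].
    by rewrite (_ : u 0%N = fun _ => 0); [exact: cst_continuous|apply/funext].
  rewrite (_ : u n.+1 = fun x => u n x + iter n transfer psi x); last exact/funext.
  by move=> x; apply: cvgD; [exact: IH|exact: iter_transfer_cont].
have um n : mean (u n) = 0.
  elim: n => [|n IH].
    by rewrite (_ : u 0%N = fun _ => 0); [rewrite segint_cst// mul0r|apply/funext].
  rewrite (_ : u n.+1 = fun x => u n x + iter n transfer psi x); last exact/funext.
  by rewrite segintD//; [rewrite IH mean_iter_transfer// m0 addr0|exact: iter_transfer_cont].
have uhol n x y : `|u n x - u n y| <= M / (1 - r) * (1 - r ^+ n) * `|x - y| `^ gam.
  elim: n => [|n IH]; first by rewrite !u0 subrr normr0 expr0 subrr mulr0 mul0r.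
  rewrite !uS opprD addrACA; apply: le_trans (ler_normD _ _) _.
  have -> : M / (1 - r) * (1 - r ^+ n.+1) * `|x - y| `^ gam =
    M / (1 - r) * (1 - r ^+ n) * `|x - y| `^ gam + M * r ^+ n * `|x - y| `^ gam.
    by rewrite exprS; field; rewrite subr_eq0 eq_sym lt_eqF.
  by apply: lerD => //; exact: (hM n).2.
have M1 : 0 <= M / (1 - r) by rewrite divr_ge0// subr_ge0 ltW.
have chiH : holder_continuous gam chi.
  exists (M / (1 - r)) => x y.
  apply: (@ler_geometricD _ _ _ (M / (1 - r) + M / (1 - r)) r r_itv) => n.
  have -> : chi x - chi y = (u n x - u n y) + ((chi x - u n x) - (chi y - u n y)) by ring.
  apply: le_trans (ler_normD _ _) _; apply: lerD.
    apply: le_trans (uhol n x y) _; rewrite ler_wpM2r ?powR_ge0//.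
    by rewrite ler_piMr// gerBl exprn_ge0.
  by apply: le_trans (ler_normB _ _) _; rewrite mulrDl; apply: lerD; exact: hu.
have chic : continuous chi by exact: holder_cont gam_gt0 _ chiH.
have chip : periodic chi 1.
  by move=> x; rewrite /chi (_ : u^~ (x + 1) = u^~ x)//; apply/funext => n; exact: up.
exists chi; split=> //.
- by split=> //; exact: periodic_bounded.
- apply: (@geometric_eq0 _ _ (M / (1 - r)) r) => // n.
  have <- : mean (fun x => chi x - u n x) = mean chi by rewrite segintB// um subr0.
  rewrite -[leRHS]mulr1 -[X in _ * X](subr0 1); apply: segint_norm_le => //.
    by move=> x; apply: cvgB; [exact: chic|exact: uc].
  by move=> x _; exact: hu.
- move=> x; apply/eqP; rewrite -subr_eq0; apply/eqP.
  have [Q Q0 hQ] := transfer1_bound.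
  apply: (@geometric_eq0 _ _ (M / (1 - r) + Q * (M / (1 - r))) r) => // n.
  have tu : transfer (u n) x = u n.+1 x - psi x.
    elim: n x => [|n IH] x.
      rewrite uS u0 add0r subrr (_ : u 0%N = fun y => 0 * u 0%N y).
        by rewrite transferZ mul0r.
      by apply/funext => y; rewrite u0 mulr0.
    rewrite (_ : u n.+1 = fun x => u n x + iter n transfer psi x); last exact/funext.
    by rewrite transferD IH uS (uS n.+1) uS /=; ring.
  have h1 := hu x n.+1; have h2 := hQ (fun y => chi y - u n y) _ (fun y => hu y n) x.
  rewrite transferB tu in h2; rewrite -/(chi x) in h1.
  have -> : chi x - transfer chi x - psi x = (chi x - u n.+1 x) -
    (transfer chi x - (u n.+1 x - psi x)) by ring.
  apply: le_trans (ler_normB _ _) _; rewrite mulrDl; apply: lerD; last by rewrite -mulrA.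
  apply: le_trans h1 _; rewrite ler_wpM2l// exprS ler_piMl ?exprn_ge0//.
  exact: ltW.
Qed.

(** With chi - L chi = L 1 - 1 the function 1 + chi is invariant.  It is positive
    because it equals L^n 1 + L^n chi for every n, where L^n 1 stays in the cone and
    L^n chi tends to 0. *)
Lemma invariant_density : exists rho, [/\ bholder gam rho, periodic rho 1,
  mean rho = 1, exists2 c, 0 < c & forall x, c <= rho x &
  forall x, transfer rho x = rho x].
Proof.
have b1 : bholder gam (fun _ : R => 1) by exact: bholder_cst.
have [n1 m1] := ncone1.
have tn := transfer_cone (ltW a_gt0) n1.
have /andP[a'0 _] := a'_itv.
have cc1 : continuous (fun _ : R => (1 : R)) by exact: cst_cont.
have [chi [bchi pchi mchi echi]] :
  exists chi, [/\ bholder gam chi, periodic chi 1, mean chi = 0 &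
    forall x, chi x - transfer chi x = transfer (fun _ => 1) x - 1].
  apply: resolvent.
  - by apply: bholderB => //; exact: cone_bholder (ltW a'0) tn.
  - by move=> x; congr (_ - _); exact: transfer_per.
  - rewrite segintB//; last exact: transfer_cont.
    by rewrite mean_transfer// m1 subrr.
have cchi : continuous chi by case: bchi => _; exact: holder_cont.
have pos n : ncone a (iter n transfer (fun _ => 1)).
  elim: n => [|n [[pf f0 hf] mf]]; first exact: ncone1.
  have cf := transfer_cone (ltW a_gt0) (And3 pf f0 hf).
  split; last first.
    rewrite mean_transfer//; apply: (holder_cont gam_gt0).
    by case: (cone_bholder (ltW a_gt0) (And3 pf f0 hf)).
  case: cf => p2 f2 h2; split=> // x y; apply: le_trans (h2 x y) _.
  rewrite ler_wpM2r ?(ltW (f2 y))// ler_expR ler_wpM2r ?powR_ge0//.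
  by rewrite -/a'; have /andP[_ /ltW] := a'_itv.
have fix_rho x : transfer (fun x => 1 + chi x) x = 1 + chi x.
  by rewrite transferD; have := echi x; lra.
exists (fun x => 1 + chi x); split.
- exact: bholderD.
- by move=> x; rewrite pchi.
- by rewrite segintD// m1 mchi addr0.
- exists (expR (- a)); first exact: expR_gt0.
  move=> x; have [M M0 hM] := transfer_decay bchi pchi mchi.
  have itf n : iter n transfer (fun x => 1 + chi x) = fun x => 1 + chi x.
    by elim: n => //= n ->; apply/funext.
  apply: (@ler_geometricD _ _ _ M r r_itv) => n.
  rewrite -[1 + chi x](congr1 (@^~ x) (itf n)) iter_transferD.
  have /andP[+ _] := ncone_bounds (ltW a_gt0) (pos n) x.
  have := (hM n).1 x; rewrite ler_norml => /andP[+ _].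
  by lra.
- exact: fix_rho.
Qed.

Lemma transfer_equidistribution rho k : bholder gam rho -> periodic rho 1 ->
    mean rho = 1 -> (forall x, transfer rho x = rho x) ->
    bholder gam k -> periodic k 1 ->
  forall e, 0 < e -> \forall n \near \oo,
    forall x, `|iter n transfer k x - mean k * rho x| <= e.
Proof.
move=> brho prho mrho frho bk pk.
have ck : continuous k by case: bk => _; exact: holder_cont.
have crho : continuous rho by case: brho => _; exact: holder_cont.
have [|||M M0 hM] := @transfer_decay (fun x => k x - mean k * rho x).
- by apply: bholderB => //; apply: bholderM => //; exact: bholder_cst.
- by move=> x; rewrite pk prho.
- rewrite segintB//; last by move=> x; apply: cvgMr; exact: crho.
  by rewrite segintZ// mrho mulr1 subrr.
move=> e e0; have /andP[r0 r1] := r_itv.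
have : M * r ^+ n @[n --> \oo] --> M * 0.
  by apply: cvgMr; apply: cvg_expr; rewrite ger0_norm.
rewrite mulr0 => /cvgrPdist_le/(_ _ e0); apply: filterS => n /=.
rewrite sub0r normrN ger0_norm ?mulr_ge0 ?exprn_ge0// => hn x.
have := (hM n).1 x; rewrite iter_transferB iter_transferZ.
have -> : iter n transfer rho = rho by elim: (n) => //= m ->; apply/funext.
by move/le_trans; apply.
Qed.

End transfer_operator.

(** * Periodic Lipschitz functions are dense in the integrable functions *)

Section lipschitz_density.
Context {R : realType}.
Implicit Types (f g h k : R -> R) (x y : R).

Lemma mean_value_in f (df : R -> R) (a b : R) : a <= b -> (forall x, is_derive x 1 f (df x)) ->
  exists2 c, a <= c <= b & f b - f a = df c * (b - a).
Proof.
move=> ab h; have cf : continuous f by exact: is_derive_continuous h.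
have [c + e] := @MVT_segment _ f df a b ab (fun x _ => h x)
  (continuous_subspaceT cf).
by rewrite in_itv/=; exists c.
Qed.

Lemma segment_bounded g (a b : R) : continuous g -> a <= b ->
  exists B, forall x, a <= x <= b -> `|g x| <= B.
Proof.
move=> cg ab; have cn : continuous (fun x => `|g x|).
  by move=> x; apply: cvg_norm; exact: cg.
have [c _ hc] := @EVT_max R (fun x => `|g x|) a b ab (continuous_subspaceT cn).
by exists `|g c| => x hx; apply: hc; rewrite in_itv.
Qed.

Lemma lipschitz_on_segment f (df : R -> R) (a b : R) : a <= b -> (forall x, is_derive x 1 f (df x)) ->
  continuous df -> exists2 L, 0 <= L & forall x y, a <= x <= b -> a <= y <= b ->
    `|f x - f y| <= L * `|x - y|.
Proof.
move=> ab hf cdf; have [L hL] := segment_bounded cdf ab; exists L.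
  by apply: le_trans (hL a _); rewrite ?lexx.
have wl x y : a <= x <= b -> a <= y <= b -> x <= y -> `|f x - f y| <= L * `|x - y|.
  move=> /andP[ax xb] /andP[ay yb] xy; have [c /andP[xc cy] e] := mean_value_in xy hf.
  rewrite distrC e normrM (distrC x) ler_wpM2r//; apply: hL.
  by rewrite (le_trans ax xc) (le_trans cy yb).
move=> x y hx hy; have [xy|/ltW yx] := leP x y; first exact: wl.
by rewrite distrC (distrC x); exact: wl.
Qed.

Lemma lipschitz_continuous k L : (forall x y, `|k x - k y| <= L * `|x - y|) ->
  continuous k.
Proof.
move=> hL; apply: (holder_cont (gam := 1)) => //.
by exists L => x y; rewrite powRr1.
Qed.

(** If x < y have different integer parts, then y - x is at least the distance from
    the fractional part of x up to 1 plus that from 0 to the fractional part of y,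
    and f takes the same value at 0 and 1. *)
Lemma periodize_lipschitz f L : 0 <= L -> f 0 = f 1 ->
  (forall x y, 0 <= x <= 1 -> 0 <= y <= 1 -> `|f x - f y| <= L * `|x - y|) ->
  forall x y, `|f (fracpart x) - f (fracpart y)| <= L * `|x - y|.
Proof.
move=> L0 f01 hL.
have wl x y : x <= y -> `|f (fracpart x) - f (fracpart y)| <= L * `|x - y|.
  move=> xy; have /andP[x0 x1] := fracpart_itv x; have /andP[y0 y1] := fracpart_itv y.
  have x01 : 0 <= fracpart x <= 1 by rewrite x0 ltW.
  have y01 : 0 <= fracpart y <= 1 by rewrite y0 ltW.
  have [e|ne] := eqVneq (Num.floor x) (Num.floor y).
    apply: le_trans (hL _ _ x01 y01) _; rewrite /fracpart e.
    by rewrite opprB addrA subrK.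
  have fl : ((Num.floor x)%:~R + 1 : R) <= (Num.floor y)%:~R.
    have := le_floor xy; rewrite le_eqVlt (negbTE ne)/= -lezD1.
    by rewrite -(ler_int R) intrD.
  have -> : f (fracpart x) - f (fracpart y) =
    (f (fracpart x) - f 1) + (f 0 - f (fracpart y)) by rewrite f01; ring.
  apply: le_trans (ler_normD _ _) _.
  have h1 := hL _ 1 x01; have h2 := hL 0 _ _ y01.
  have {}h1 := h1 (_ : 0 <= 1 <= 1); have {}h2 := h2 (_ : 0 <= 0 <= 1).
  rewrite ler01 lexx in h1; rewrite lexx ler01 in h2.
  apply: le_trans (lerD (h1 isT) (h2 isT)) _.
  rewrite -mulrDr ler_wpM2l// (distrC x) sub0r normrN (ger0_norm y0).
  rewrite (ltr0_norm (x := fracpart x - 1)) ?subr_lt0// ger0_norm ?subr_ge0//.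
  by move: fl; rewrite /fracpart; lra.
move=> x y; have [xy|/ltW yx] := leP x y; first exact: wl.
by rewrite distrC (distrC x); exact: wl.
Qed.

(** Moving averages of g are continuously differentiable and converge to g
    pointwise.  A multiple of x^n, which tends to 0 on [0, 1[, is added to make the
    values at 0 and 1 agree, so that the periodic extension is Lipschitz. *)
Lemma lipschitz_dense_continuous g e : continuous g -> 0 < e ->
  exists k, [/\ periodic k 1, exists L, forall x y, `|k x - k y| <= L * `|x - y| &
    mean (fun x => `|g x - k x|) <= e].
Proof.
move=> cg e0; have [P dP] := exists_primitive cg.
have [B hB] := @segment_bounded g 0 2 cg (ler0n _ _).
have B0 : 0 <= B by apply: le_trans (hB 0 _); rewrite ?lexx ?ler0n.
pose m n x : R := (P (x + n.+1%:R^-1) - P x) * n.+1%:R.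
pose f n x := m n x + (m n 0 - m n 1) * x ^+ n.+1.
have in0 n : 0 < n.+1%:R^-1 :> R by rewrite invr_gt0 ltr0n.
have in1 n : n.+1%:R^-1 <= 1 :> R by rewrite invf_le1// ler1n.
have mE n x : exists2 c, x <= c <= x + n.+1%:R^-1 & m n x = g c.
  have xx : x <= x + n.+1%:R^-1 by rewrite lerDl ltW.
  have [c hc ec] := mean_value_in xx dP; exists c => //.
  by rewrite /m ec addrC addKr mulfVK// pnatr_eq0.
have mB n x : 0 <= x <= 1 -> `|m n x| <= B.
  move=> /andP[x0 x1]; have [c /andP[xc cx] ->] := mE n x; apply: hB.
  rewrite (le_trans x0 xc)/=; apply: le_trans cx _.
  by apply: le_trans (lerD x1 (in1 n)) _; lra.
have df n x : is_derive x 1 (f n) ((g (x + n.+1%:R^-1) - g x) * n.+1%:R +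
    (m n 0 - m n 1) * (n.+1%:R * x ^+ n)).
  have d1 : is_derive x 1 (fun x => P (x + n.+1%:R^-1)) (g (x + n.+1%:R^-1)).
    have dd := dP (x + n.+1%:R^-1).
    rewrite -[X in is_derive _ _ _ X]mulr1.
    apply: (@is_derive1_comp _ P (fun x : R => x + n.+1%:R^-1)) => //.
    by rewrite -[X in is_derive _ _ _ X]addr0; apply: is_deriveD.
  have d2 : is_derive x 1 (m n) ((g (x + n.+1%:R^-1) - g x) * n.+1%:R).
    rewrite /m [X in is_derive _ _ _ X]mulrC.
    rewrite (_ : (fun x => _) = (fun x => n.+1%:R *: (P (x + n.+1%:R^-1) - P x))).
      exact: is_deriveZ.
    by apply/funext => y; rewrite mulrC.
  have d3 : is_derive x 1 (fun x : R => (m n 0 - m n 1) * x ^+ n.+1)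
     ((m n 0 - m n 1) * (n.+1%:R * x ^+ n)).
    apply: (@is_deriveZ _ _ _ (fun x => x ^+ n.+1)).
    have := @is_deriveX _ _ (@id R) n.+1 x 1 1 _.
    by rewrite exprfctE /GRing.scale/= mulr1; apply; exact: is_derive_id.
  exact: is_deriveD.
have f01 n : f n 0 = f n 1 by rewrite /f expr0n expr1n/= mulr0 addr0; ring.
have cm n : continuous (f n) by exact: is_derive_continuous (df n).
have ldf n : exists2 L, 0 <= L & forall x y, 0 <= x <= 1 -> 0 <= y <= 1 ->
    `|f n x - f n y| <= L * `|x - y|.
  apply: lipschitz_on_segment (df n) _; first exact: ler01.
  move=> x; apply: cvgD.
    apply: cvgMl; apply: cvgB; last exact: cg.
    apply: (@continuous_comp _ _ _ (fun x : R => x + n.+1%:R^-1) g); last exact: cg.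
    by apply: cvgD; [exact: cvg_id|exact: cvg_cst].
  by apply: cvgMr; apply: cvgMr; exact: exprn_continuous.
pose k n x := f n (fracpart x).
have kf n x : 0 <= x < 1 -> k n x = f n x.
  move=> /andP[x0 x1]; rewrite /k /fracpart (_ : Num.floor x = 0) ?subr0//.
  by apply/eqP; rewrite floor_eq x0.
have pk n : periodic (k n) 1.
  by move=> x; rewrite /k /fracpart floorDrz// intrD; congr f; rewrite floor1/=; ring.
have lk n : exists L, forall x y, `|k n x - k n y| <= L * `|x - y|.
  by have [L L0 hL] := ldf n; exists L; exact: periodize_lipschitz.
have ck n : continuous (k n) by have [L hL] := lk n; exact: lipschitz_continuous hL.
have fg x : 0 <= x < 1 -> f n x @[n --> \oo] --> g x.
  move=> /andP[x0 x1]; rewrite -[X in _ --> X]addr0; apply: cvgD.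
    apply/cvgrPdist_le => d d0.
    have /cvgrPdist_le/(_ d d0)/nbhs_ballP[t /= t0 ht] := cg x.
    have /cvgrPdist_lt/(_ t t0) := @cvg_harmonic R.
    apply: filterS => n /=; rewrite sub0r normrN ger0_norm ?(ltW (in0 n))// => nt.
    have [c /andP[xc cx] ->] := mE n x; apply: ht; rewrite /ball/=.
    have {}nt : n.+1%:R^-1 < t := nt.
    by rewrite ler0_norm ?subr_le0//; move: (n.+1%:R^-1 : R) cx nt => i cx nt; lra.
  apply/cvgrPdist_le => d d0.
  have : 2 * B * x ^+ n.+1 @[n --> \oo] --> 2 * B * 0.
    by apply: cvgMr; rewrite (cvg_shiftS (fun n => x ^+ n)); apply: cvg_expr; rewrite ger0_norm.
  rewrite mulr0 => /cvgrPdist_le/(_ d d0); apply: filterS => n /=.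
  rewrite !sub0r !normrN; apply: le_trans; rewrite [leRHS]normrM normrM.
  rewrite ler_wpM2r// [leRHS]ger0_norm ?mulr_ge0//.
  apply: le_trans (ler_normB _ _) _; have := mB n 0; have := mB n 1.
  by rewrite !lexx ler01 => /(_ isT) ? /(_ isT); lra.
have fB n x : 0 <= x < 1 -> `|g x - f n x| <= 4 * B.
  move=> /andP[x0 x1]; have h1 := mB n x; rewrite x0 ltW// in h1; have {}h1 := h1 isT.
  have h2 : `|g x| <= B by apply: hB; apply/andP; split; lra.
  have := mB n 0; have := mB n 1; rewrite !lexx ler01 => /(_ isT) h3 /(_ isT) h4.
  have h5 : `|(m n 0 - m n 1) * x ^+ n.+1| <= 2 * B.
    rewrite normrM (@le_trans _ _ `|m n 0 - m n 1|)//; last first.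
      by apply: le_trans (ler_normB _ _) _; lra.
    rewrite ler_piMr// ger0_norm ?exprn_ge0// exprn_ile1//; exact: ltW.
  rewrite /f; apply: le_trans (ler_normB _ _) _.
  by have := ler_normD (m n x) ((m n 0 - m n 1) * x ^+ n.+1); lra.
have co n : continuous (fun x => `|g x - k n x|).
  by move=> x; apply: cvg_norm; apply: cvgB; [exact: cg|exact: ck].
have key : (\int[@lebesgue_measure R]_(x in `[0%R, 1%R[) (`|g x - k n x|%:E))%E
     @[n --> \oo] --> (\int[@lebesgue_measure R]_(x in `[0%R, 1%R[) (cst 0 x))%E.
  apply: (@dominated_cvg _ _ _ _ _ _ _ _ (cst (4 * B)%:E)) => //.
  - move=> n; apply/measurable_EFinP; apply: measurable_funTS.
    exact: continuous_measurable_fun.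
  - move=> x; rewrite /= in_itv/= => x01; apply/fine_cvgP; split; first by near=> n.
    rewrite (_ : fine \o _ = fun n => `|g x - f n x|); last first.
      by apply/funext => n /=; rewrite kf.
    have : `|g x - f n x| @[n --> \oo] --> `|g x - g x|.
      by apply: cvg_norm; apply: cvgB; [exact: cvg_cst|exact: fg].
    by rewrite subrr normr0.
  - apply: (integrableS _ _ _ (@continuous_integrable _ _ 0 1 (@cst_continuous _ _ (4 * B)))) => //.
    by apply: subset_itvl; rewrite bnd_simp.
  - by move=> n x; rewrite /= in_itv/= => x01; rewrite lee_fin normr_id kf// fB.
rewrite integral0 in key.
have [_ /cvgrPdist_le/(_ e e0)[N _ /(_ N (leqnn _))]] := (fine_cvgP _ _).1 key.
rewrite /= sub0r normrN => hN.
exists (k N); split=> //; apply: le_trans hN; apply: le_trans (ler_norm _).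
rewrite -/(Rintegral _ _ _) /segint -Rintegral_itv_bndo_bndc//.
apply: (integrableS _ _ _ (@continuous_integrable _ _ 0 1 (co N))) => //.
by apply: subset_itvl; rewrite bnd_simp.
Unshelve. all: by end_near. Qed.

(** Against a bounded sequence, an L^1 approximation of h changes the integral by
    little, uniformly in n. *)
Lemma weak_cvg_integrable (theta : nat -> R -> R) (C : R) h :
    (forall n, continuous (theta n)) -> (forall n x, `|theta n x| <= C) ->
    (forall k, periodic k 1 -> (exists L, forall x y, `|k x - k y| <= L * `|x - y|) ->
      mean (fun x => k x * theta n x) @[n --> \oo] --> 0) ->
    (@lebesgue_measure R).-integrable `[0, 1] (EFin \o h) ->
  \int[@lebesgue_measure R]_(x in `[0, 1]) (h x * theta n x) @[n --> \oo] --> 0.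
Proof.
move=> ct bt wk ih; pose D : set (measurableTypeR R) := `[0, 1]%classic; have mD : measurable (D : set (measurableTypeR R)) by exact: measurable_itv.
have C0 : 0 <= C by apply: le_trans (bt 0%N 0).
have iM f n : (@lebesgue_measure R).-integrable D (EFin \o f) ->
    (@lebesgue_measure R).-integrable D (EFin \o (fun x => f x * theta n x)).
  move=> jf.
  have := @integrableMl _ _ _ (@lebesgue_measure R) D mD (EFin \o f) (theta n) jf.
  apply; first by apply: measurable_funTS; exact: continuous_measurable_fun.
  exists C; split; first by rewrite num_real.
  by move=> y Cy x _ /=; apply: le_trans (bt n x) (ltW Cy).
have bd f n e : (@lebesgue_measure R).-integrable D (EFin \o f) ->
    \int[@lebesgue_measure R]_(x in D) `|f x| <= e ->
    `|\int[@lebesgue_measure R]_(x in D) (f x * theta n x)| <= C * e.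
  move=> jf he; have jn : (@lebesgue_measure R).-integrable D (EFin \o (fun x => `|f x|)).
    exact: (integrable_norm jf).
  apply: le_trans (le_normr_Rintegral mD (iM f n jf)) _.
  apply: (@le_trans _ _ (C * \int[@lebesgue_measure R]_(x in D) `|f x|)); last first.
    by rewrite ler_wpM2l.
  rewrite -RintegralZl//; apply: le_Rintegral => //.
  - exact: (integrable_norm (iM f n jf)).
  - by have := integrableZl mD C jn; apply: eq_integrable.
  - by move=> x _; rewrite normrM mulrC ler_wpM2r.
apply/cvgrPdist_le => e e0.
pose e' := e / (2 * (C + 1)) / 2.
have e'0 : 0 < e' by rewrite !divr_gt0// mulr_gt0//; lra.
have mfin : (@lebesgue_measure R D < +oo)%E.
  by rewrite /D lebesgue_measure_itv/= lte_fin ltr01 -EFinB ltry.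
have [g_ [cg ig]] := approximation_continuous_integrable mD mfin ih.
move=> /fine_cvgP[fin_g /cvgrPdist_le/(_ e' e'0) small_g].
near \oo => N.
pose g := g_ N.
have cgN : continuous g := cg N.
have hg : \int[@lebesgue_measure R]_(x in D) `|h x - g x| <= e'.
  have : `|0 - fine (\int[@lebesgue_measure R]_(z in D) `|(h z - g_ N z)%:E|)%E| <= e'.
    by near: N.
  by rewrite sub0r normrN => /(le_trans (ler_norm _)).
have [k [pk Lk gk]] := lipschitz_dense_continuous cgN e'0.
have ck : continuous k by have [L hL] := Lk; exact: lipschitz_continuous hL.
have ihg : (@lebesgue_measure R).-integrable D (EFin \o (fun x => h x - g x)).
  by have := integrableB mD ih (@continuous_integrable _ _ 0 1 cgN); apply: eq_integrable.
have igk : (@lebesgue_measure R).-integrable D (EFin \o (fun x => g x - k x)).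
  by apply: continuous_integrable => x; apply: cvgB; [exact: cgN|exact: ck].
have ik : (@lebesgue_measure R).-integrable D (EFin \o k) by exact: continuous_integrable.
have e2 : 0 < e / 2 by rewrite divr_gt0.
have := wk k pk Lk => /cvgrPdist_le/(_ _ e2); apply: filterS => n.
rewrite !sub0r !normrN => hn.
have -> : \int[@lebesgue_measure R]_(x in D) (h x * theta n x) =
   \int[@lebesgue_measure R]_(x in D) ((h x - g x) * theta n x) +
   (\int[@lebesgue_measure R]_(x in D) ((g x - k x) * theta n x) +
    \int[@lebesgue_measure R]_(x in D) (k x * theta n x)).
  rewrite -RintegralD//; [|exact: iM|exact: iM].
  rewrite -RintegralD//; [|exact: iM|].
    by apply: eq_Rintegral => x _; ring.
  have := integrableD mD (iM _ n igk) (iM _ n ik); exact: eq_integrable.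
have b1 := bd _ n _ ihg hg; have b2 := bd _ n _ igk gk.
have hC : C * e' + C * e' <= e / 2.
  have -> : C * e' + C * e' = (C / (C + 1)) * (e / 2) by rewrite /e'; field; lra.
  by rewrite ler_piMl ?(ltW e2)// ler_pdivrMr; lra.
apply: le_trans (ler_normD _ _) _.
apply: le_trans (lerD b1 (le_trans (ler_normD _ _) (lerD b2 hn))) _.
by rewrite addrA (le_trans (lerD hC (lexx _)))// -splitr.
Unshelve. all: by end_near. Qed.

End lipschitz_density.

(** * The transfer operator of an expanding circle map *)

Section expanding_lift.
Context {R : realType}.
Variables (F dF : R -> R) (d : int) (lam gam : R).
Hypothesis F_lift : forall x, F (x + 1) = F x + d%:~R.
Hypothesis F_der : forall x : R, is_derive x 1 F (dF x).
Hypothesis lam_gt1 : 1 < lam.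
Hypothesis dF_lam : forall x, lam <= `|dF x|.
Hypothesis gam_gt0 : 0 < gam.
Hypothesis dF_holder : bholder gam dF.
Implicit Types (x y : R) (psi k g : R -> R).

Lemma dF_periodic : periodic dF 1.
Proof. exact: derive_periodic F_lift F_der. Qed.

Lemma dF_continuous : continuous dF.
Proof. by case: dF_holder => _; exact: holder_cont. Qed.

Lemma F_continuous : continuous F.
Proof. exact: is_derive_continuous F_der. Qed.

Lemma lam_gt0 : 0 < lam.
Proof. exact: lt_trans ltr01 lam_gt1. Qed.

Lemma dF_neq0 x : dF x != 0.
Proof. by rewrite -normr_gt0; exact: lt_le_trans lam_gt0 (dF_lam x). Qed.

Lemma dF_sign : exists s : R, (s = 1 \/ s = -1) /\ forall x, s * dF x = `|dF x|.
Proof.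
have same x y : 0 < dF x -> 0 < dF y.
  move=> x0; have [//|y0] := ltP 0 (dF y).
  have neg u v : Num.min (dF u) (dF v) <= 0 <= Num.max (dF u) (dF v) -> u <= v -> False.
    move=> h uv; have [c _ /eqP] := IVT uv (continuous_subspaceT dF_continuous) h.
    by rewrite (negbTE (dF_neq0 c)).
  have [xy|/ltW yx] := leP x y.
    case: (neg x y) => //; rewrite ge_min le_max y0 orbT/=.
    by rewrite ltW.
  case: (neg y x) => //; rewrite ge_min le_max y0 /=.
  by rewrite (ltW x0) orbT.
have [p0|n0] := ltP 0 (dF 0).
  exists 1; split; first by left.
  by move=> x; rewrite mul1r gtr0_norm// (same _ _ p0).
exists (-1); split; first by right.
move=> x; rewrite mulN1r ler0_norm// leNgt; apply/negP => /(same _ 0).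
by rewrite ltNge n0.
Qed.

Let D := `|d|%N.

(** The sign s of the derivative of F is that of the degree: increasing the argument
    by s increases F by D = |d|.  It lets orientation preserving and orientation
    reversing maps be treated together. *)
Lemma orientation : exists s : R, [/\ s = 1 \/ s = -1,
  forall x, s * dF x = `|dF x|, (0 < D)%N & forall x, F (x + s) = F x + D%:R].
Proof.
have [s [s1 hs]] := dF_sign; exists s.
have [c e] := mean_value 0 1 F_der.
have e1 : d%:~R = dF c by move: e; have := F_lift 0; rewrite add0r => ->; lra.
have sd : s * d%:~R = D%:R.
  have : `|s * d%:~R| = D%:R.
    rewrite normrM /D; have -> : `|s| = 1 by case: s1 => ->; rewrite ?normrN normr1.
    by rewrite mul1r natr_absz intr_norm.
  by move=> <-; rewrite e1 hs normr_id.
split=> //.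
  rewrite /D absz_gt0; apply/eqP => d0; have := dF_neq0 c.
  by rewrite -e1 d0 eqxx.
move=> x; rewrite -sd; case: s1 => ->; first by rewrite F_lift mul1r.
by have := F_lift (x - 1); rewrite subrK => ->; ring.
Qed.

Lemma F_expand x y : lam * `|x - y| <= `|F x - F y|.
Proof. exact: expanding_of_derive F_der dF_lam x y. Qed.

Lemma F_injective : injective F.
Proof.
move=> x y e; have := F_expand x y; rewrite e subrr normr0 => h.
have : `|x - y| <= 0 by rewrite -(pmulr_rle0 _ (lt_trans ltr01 lam_gt1)).
by rewrite normr_le0 subr_eq0 => /eqP.
Qed.

Lemma F_nat (s : R) n x : (forall x, F (x + s) = F x + D%:R) ->
  F (x + s * n%:R) = F x + (n * D)%:R.
Proof.
move=> hs; elim: n => [|n IH]; first by rewrite mulr0 addr0 mul0n addr0.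
by rewrite -addn1 mulnDl mul1n !natrD mulrDr mulr1 !addrA hs IH.
Qed.

Lemma F_surjective y : exists x, F x = y.
Proof.
have [s [s1 _ D0 hs]] := orientation.
pose n := (Num.truncn `|y - F 0|).+1.
have hn : `|y - F 0| <= (n * D)%:R.
  apply: (@le_trans _ _ n%:R); last by rewrite ler_nat leq_pmulr.
  by apply: ltW; rewrite /n; exact: truncnS_gt.
have e1 := F_nat n 0 hs.
have e2 := F_nat n (- (s * n%:R)) hs; rewrite addNr in e2.
move: hn; rewrite ler_norml => /andP[h1 h2].
have up : y <= F (s * n%:R) by move: e1; rewrite add0r; lra.
have lo : F (- (s * n%:R)) <= y by lra.
have cF := continuous_subspaceT F_continuous.
have [ab|/ltW ba] := leP (- (s * n%:R)) (s * n%:R).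
  have [|c _ e] := @IVT _ F _ _ y ab (cF _); last by exists c.
  by rewrite ge_min le_max lo up orbT.
have [|c _ e] := @IVT _ F _ _ y ba (cF _); last by exists c.
by rewrite ge_min le_max lo up !orbT.
Qed.

Definition lift_inv y : R := projT1 (cid (F_surjective y)).
Local Notation G := lift_inv.

Lemma lift_invK y : F (G y) = y.
Proof. by rewrite /lift_inv; case: cid. Qed.

Lemma FK x : G (F x) = x.
Proof. by apply: F_injective; rewrite lift_invK. Qed.

Lemma lift_inv_contract x y : `|G x - G y| <= lam^-1 * `|x - y|.
Proof.
rewrite -ler_pdivrMl ?invr_gt0 ?(lt_trans ltr01)// invrK.
by rewrite -{2}(lift_invK x) -{2}(lift_invK y) F_expand.
Qed.

Lemma lift_inv_shift (s : R) y : (forall x, F (x + s) = F x + D%:R) ->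
  G (y + D%:R) = G y + s.
Proof. by move=> hs; apply: F_injective; rewrite hs !lift_invK. Qed.

Lemma lift_inv_per psi y : periodic psi 1 -> psi (G (y + D%:R)) = psi (G y).
Proof.
move=> pp; have [s [s1 _ _ hs]] := orientation; rewrite (lift_inv_shift y hs).
by case: s1 => ->; [exact: pp|rewrite -{2}(subrK 1 (G y)) pp].
Qed.

Lemma lift_inv_derive y : is_derive y 1 G (dF (G y))^-1.
Proof.
have := @is_derive_inverse _ F G (dF (G y)) (G y) _ _ (F_der _) (dF_neq0 _).
rewrite lift_invK; apply.
- by near=> x; exact: FK.
- by near=> x; exact: F_continuous.
Unshelve. all: by end_near. Qed.

Definition weight x : R := `|dF x|^-1.
Local Notation L := (transfer D G weight).

Lemma weight_gt0 x : 0 < weight x.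
Proof. by rewrite invr_gt0 normr_gt0 dF_neq0. Qed.

Lemma weight_per : periodic weight 1.
Proof. by move=> x; rewrite /weight dF_periodic. Qed.

Lemma weight_continuous : continuous weight.
Proof.
move=> x; apply: cvgV; first by rewrite normr_eq0 dF_neq0.
by apply: cvg_norm; exact: dF_continuous.
Qed.

Lemma weight_dist : exists2 K, 0 <= K &
  forall x y, weight x <= expR (K * `|x - y| `^ gam) * weight y.
Proof.
have [K K0 hK] := holder_ge0 dF_holder.2; exists K => // x y.
have ax := le_trans (ltW lam_gt1) (dF_lam x); have K1 : 0 <= K * `|x - y| `^ gam by rewrite mulr_ge0 ?powR_ge0.
rewrite /weight ler_pdivlMr ?normr_gt0 ?dF_neq0// mulrC ler_pdivrMr ?normr_gt0 ?dF_neq0//.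
have h1 : `|dF y| <= `|dF x| + K * `|x - y| `^ gam.
  have := hK x y; have := ler_normB (dF x) (dF x - dF y).
  by rewrite opprB addrC subrK; lra.
apply: (@le_trans _ _ ((1 + K * `|x - y| `^ gam) * `|dF x|)); last first.
  by rewrite ler_wpM2r// expR_ge1Dx.
by apply: le_trans h1 _; rewrite mulrDl mul1r lerD2l ler_peMr//; lra.
Qed.

Lemma lam_inv_itv : 0 < lam^-1 < 1.
Proof. by rewrite invr_gt0 lam_gt0 invf_lt1 ?lam_gt0. Qed.

(** If P is a primitive of psi, then s P (G (x + i)), summed over i < D, is a
    primitive of L psi, and its increment over a period telescopes to an increment
    of P over a period. *)
Lemma mean_transfer psi : continuous psi -> periodic psi 1 ->
  mean (L psi) = mean psi.
Proof.
move=> cp pp; have [P dP] := exists_primitive cp.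
have [s [s1 hs D0 Fs]] := orientation.
have ss : s * s = 1 by case: s1 => ->; ring.
pose h (i : 'I_D) x := s * P (G (x + i%:R)).
have dh (i : 'I_D) x : is_derive x 1 (h i) (weight (G (x + i%:R)) * psi (G (x + i%:R))).
  have d1 : is_derive x 1 (fun x : R => x + i%:R) 1.
    by rewrite -[X in is_derive _ _ _ X]addr0; apply: is_deriveD.
  have d2 := @is_derive1_comp _ G (fun x : R => x + i%:R) x _ _ (lift_inv_derive _) d1.
  have d3 := @is_derive1_comp _ P _ x _ _ (dP _) d2.
  have d4 := @is_deriveZ _ _ _ _ s _ _ _ d3.
  have e : weight (G (x + i%:R)) * psi (G (x + i%:R)) =
     s *: (psi (G (x + i%:R)) * ((dF (G (x + i%:R)))^-1 * 1)).
    rewrite /weight -hs invfM /GRing.scale/= mulr1.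
    have -> : s^-1 = s by case: s1 => ->; rewrite ?invrN invr1.
    ring.
  by rewrite e; exact: d4.
have dH x : is_derive x 1 (\sum_(i < D) h i) (L psi x).
  by rewrite /transfer; apply: is_derive_sum => i; exact: dh.
have cL : continuous (L psi).
  exact: transfer_cont lam_inv_itv lift_inv_contract weight_continuous _ cp.
rewrite (segintE cL dH)// (segintE cp dP)// !fct_sumE.
have -> : \sum_(i < D) h i 1 - \sum_(i < D) h i 0 =
    \sum_(0 <= i < D) (s * P (G i.+1%:R) - s * P (G i%:R)).
  rewrite -sumrB big_mkord; apply: eq_bigr => i _.
  by rewrite /h add0r nat1r.
rewrite telescope_sumr// -mulrBr -[in P (G D%:R)](add0r D%:R) (lift_inv_shift 0 Fs).
have per u v := primitive_shift u v pp dP.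
case: s1 => ->; first by rewrite mul1r (per _ 0) add0r.
by have := per (G 0 - 1) 0; rewrite subrK add0r => <-; ring.
Qed.

Lemma transfer_comp k psi : periodic psi 1 ->
  L (fun x => k x * psi (F x)) = fun x => L k x * psi x.
Proof.
move=> pp; apply/funext => x; rewrite /transfer mulr_suml; apply: eq_bigr => i _.
by rewrite lift_invK (periodic_nat i x pp) mulrA.
Qed.

Lemma comp_lift_per psi : periodic psi 1 -> periodic (psi \o F) 1.
Proof. by move=> pp x /=; rewrite F_lift periodic_int. Qed.

Lemma comp_lift_continuous psi : continuous psi -> continuous (psi \o F).
Proof.
by move=> cp x; apply: continuous_comp; [exact: F_continuous|exact: cp].
Qed.

Lemma comp_iter_lift_per n psi : periodic psi 1 -> periodic (fun x => psi (iter n F x)) 1.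
Proof.
elim: n psi => [//|n IH] psi pp x; rewrite !iterS.
exact: (IH _ (comp_lift_per pp)).
Qed.

Lemma comp_iter_lift_continuous n psi : continuous psi ->
  continuous (fun x => psi (iter n F x)).
Proof.
elim: n psi => [//|n IH] psi cp; exact: (IH _ (comp_lift_continuous cp)).
Qed.

Lemma continuousM_fct k g : continuous k -> continuous g -> continuous (fun x => k x * g x).
Proof. by move=> ck cg x; apply: cvgM; [exact: ck|exact: cg]. Qed.

Lemma transfer_contL psi : continuous psi -> continuous (L psi).
Proof. by move=> cp; exact: transfer_cont lam_inv_itv lift_inv_contract weight_continuous _ cp. Qed.

Lemma transfer_perL psi : periodic psi 1 -> periodic (L psi) 1.
Proof.
by move=> pp; apply: transfer_per pp; [move=> f pf x; exact: lift_inv_per|exact: weight_per].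
Qed.

Lemma mean_dual k g : continuous k -> periodic k 1 -> continuous g -> periodic g 1 ->
  mean (fun x => k x * g (F x)) = mean (fun x => L k x * g x).
Proof.
move=> ck pk cg pg; rewrite -transfer_comp// mean_transfer//.
- by apply: continuousM_fct => //; exact: comp_lift_continuous.
- by move=> x; rewrite pk; congr (_ * _); exact: (comp_lift_per pg).
Qed.

Lemma mean_dual_iter n k g : continuous k -> periodic k 1 -> continuous g ->
  periodic g 1 ->
  mean (fun x => k x * g (iter n F x)) = mean (fun x => iter n L k x * g x).
Proof.
move=> + + cg pg; elim: n k => [//|n IH] k ck pk.
have -> : (fun x => k x * g (iter n.+1 F x)) = (fun x => k x * g (iter n F (F x))).
  by apply/funext => x; rewrite iterSr.
rewrite (@mean_dual k (fun x => g (iter n F x)))//; last 2 first.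
- exact: comp_iter_lift_continuous.
- exact: comp_iter_lift_per.
rewrite IH; [|exact: transfer_contL|exact: transfer_perL].
by congr segint; apply/funext => x; rewrite -iterSr.
Qed.

Lemma F_lipschitz : exists M, forall x y, `|F x - F y| <= M * `|x - y|.
Proof.
by have [M hM] := dF_holder.1; exists M => x y; exact: lipschitz_of_derive.
Qed.

Definition is_invariant_density rho := [/\ bholder gam rho, periodic rho 1,
  mean rho = 1, exists2 c, 0 < c & forall x, c <= rho x &
  forall x, L rho x = rho x].

Lemma exists_invariant_density : exists rho, is_invariant_density rho.
Proof.
have [s [_ _ D0 _]] := orientation; have [K K0 hK] := weight_dist.
exact: (invariant_density gam_gt0 lam_inv_itv K0 D0 lift_inv_contract
  (fun f pf x => lift_inv_per x pf) weight_per weight_continuous weight_gt0 hK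
  mean_transfer).
Qed.

Section with_density.
Variable rho : R -> R.
Hypothesis rhoP : is_invariant_density rho.

Lemma rho_continuous : continuous rho.
Proof. by case: rhoP => -[_ /(holder_cont gam_gt0)]. Qed.

Lemma rho_per : periodic rho 1. Proof. by case: rhoP. Qed.

Lemma rho_invariant psi : continuous psi -> periodic psi 1 ->
  mean (fun x => rho x * psi (F x)) = mean (fun x => rho x * psi x).
Proof.
move=> cp pp; rewrite mean_dual//; [|exact: rho_continuous|exact: rho_per].
by congr segint; apply/funext => x; case: rhoP => _ _ _ _ ->.
Qed.

(** By duality the integral is that of L^n k times psi, and L^n k tends uniformly to
    the mean of k times rho. *)
Lemma equidistribution k psi : bholder gam k -> periodic k 1 ->
    continuous psi -> periodic psi 1 ->
  mean (fun x => k x * psi (iter n F x)) @[n --> \oo] -->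
    mean k * mean (fun x => rho x * psi x).
Proof.
move=> bk pk cp pp; have ck : continuous k by exact: holder_cont gam_gt0 _ bk.2.
have [B hB] := periodic_bounded cp pp; have B0 : 0 <= B by apply: le_trans (hB 0).
have [s [_ _ D0 _]] := orientation; have [K K0 hK] := weight_dist.
have [brho prho mrho _ frho] := rhoP; have crho := rho_continuous.
apply/cvgrPdist_le => e e0.
have e1 : 0 < e / (B + 1) by rewrite divr_gt0//; lra.
have := transfer_equidistribution gam_gt0 lam_inv_itv K0 D0 lift_inv_contract
  (fun f pf x => lift_inv_per x pf) weight_per weight_gt0 hK
  mean_transfer brho prho mrho frho bk pk e1.
apply: filterS => n hn; rewrite mean_dual_iter//.
have cL : continuous (iter n L k) by elim: (n) => //= m IH; exact: transfer_contL.
rewrite -segintZ; last exact: continuousM_fct.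
rewrite -segintB; [|move=> x; apply: cvgMr; exact: continuousM_fct|exact: continuousM_fct].
apply: (@le_trans _ _ (e / (B + 1) * B * (1 - 0))); last first.
  by rewrite subr0 mulr1 -mulrA ler_piMr ?(ltW e0)// mulrC ler_pdivrMr; lra.
apply: segint_norm_le => //.
  move=> x; apply: cvgB; last exact: continuousM_fct.
  apply: cvgMr; exact: continuousM_fct.
move=> x _; rewrite mulrA -mulrBl normrM; apply: ler_pM => //.
by rewrite distrC; exact: hn.
Qed.

(** Gordin's decomposition.  With chi - L chi = rho psi, w = L chi / rho and
    m = chi / rho - w o F, the equation for chi divided by rho is psi = m + w o F - w,
    and L (rho m) = L chi - w L rho = 0.  By duality the latter says that m is
    orthogonal to every function of F x, i.e. the m o F^j are reversed martingale
    differences for the measure with density rho. *)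
Lemma martingale_decomposition psi : bholder gam psi -> periodic psi 1 ->
    mean (fun x => rho x * psi x) = 0 ->
  exists w m, [/\ bholder gam w, periodic w 1, bholder gam m, periodic m 1 &
    (forall x, psi x = m x + w (F x) - w x) /\
    forall g, continuous g -> periodic g 1 ->
      mean (fun x => rho x * (m x * g (F x))) = 0].
Proof.
move=> bp pp m0.
have [s [_ _ D0 _]] := orientation; have [K K0 hK] := weight_dist.
have [brho prho mrho [c c0 hc] frho] := rhoP; have crho := rho_continuous.
have rho0 x : rho x != 0 by rewrite gt_eqF// (lt_le_trans c0).
have [chi [bchi pchi mchi echi]] : exists chi, [/\ bholder gam chi, periodic chi 1,
    mean chi = 0 & forall x, chi x - L chi x = rho x * psi x].
  apply: (resolvent gam_gt0 lam_inv_itv K0 D0 lift_inv_contract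
    (fun f pf x => lift_inv_per x pf) weight_per weight_continuous weight_gt0 hK
    mean_transfer) => //; first exact: bholderM.
  by move=> x; rewrite prho pp.
have bV : bholder gam (fun x => (rho x)^-1).
  by apply: bholderV c0 _ brho => x; apply: le_trans (hc x) (ler_norm _).
pose w x := L chi x * (rho x)^-1; pose m x := chi x * (rho x)^-1 - w (F x).
have bw : bholder gam w.
  have -> : w = fun x => (chi x - rho x * psi x) * (rho x)^-1.
    by apply/funext => x; rewrite /w -echi opprB addrC subrK.
  by apply: bholderM => //; apply: bholderB => //; exact: bholderM.
have pw : periodic w 1 by move=> x; rewrite /w prho transfer_perL.
have [M hM] := F_lipschitz.
have bm : bholder gam m.
  apply: bholderB; first exact: bholderM.
  exact: bholder_comp gam_gt0 _ _ M bw hM.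
have pm : periodic m 1.
  by move=> x; rewrite /m pchi prho; congr (_ - _); exact: (comp_lift_per pw).
have cw : continuous w by exact: holder_cont gam_gt0 _ bw.2.
have cm : continuous m by exact: holder_cont gam_gt0 _ bm.2.
exists w, m; split=> //; split.
  move=> x; rewrite /m /w subrK -mulrBl echi mulrC mulKf//.
move=> g cg pg.
have -> : (fun x => rho x * (m x * g (F x))) = (fun x => rho x * m x * g (F x)).
  by apply/funext => x; rewrite mulrA.
rewrite (@mean_dual (fun x => rho x * m x))//; last 2 first.
- exact: continuousM_fct.
- by move=> x; rewrite prho pm.
have -> : L (fun x => rho x * m x) = fun=> 0.
  have -> : (fun x => rho x * m x) = (fun x => chi x - rho x * w (F x)).
    by apply/funext => x; rewrite /m mulrBr mulrCA mulfV// mulr1.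
  rewrite transferB transfer_comp//; apply/funext => x.
  by rewrite frho /w mulrCA mulfV// mulr1 subrr.
have -> : (fun x => (fun=> 0) x * g x) = (fun=> 0) by apply/funext => x; rewrite mul0r.
by rewrite segint_cst// mul0r.
Qed.

End with_density.

End expanding_lift.

(** * The absolutely continuous invariant measure *)

Section invariant_measure.
Context {R : realType}.
Variables (F dF : R -> R) (d : int) (lam gam : R).
Variable mu : probability (measurableTypeR R) R.
Hypothesis F_lift : forall x, F (x + 1) = F x + d%:~R.
Hypothesis F_der : forall x : R, is_derive x 1 F (dF x).
Hypothesis lam_gt1 : 1 < lam.
Hypothesis dF_lam : forall x, lam <= `|dF x|.
Hypothesis gam_gt0 : 0 < gam.
Hypothesis gam_le1 : gam <= 1.
Hypothesis dF_holder : bholder gam dF.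
Hypothesis mu_circle : on_circle mu.
Hypothesis mu_inv : circle_invariant F mu.
Hypothesis mu_ac : mu `<< @lebesgue_measure R.
Implicit Types (x y : R) (psi k g : R -> R).

Lemma prob_integrable psi : continuous psi -> bounded_fct psi ->
  mu.-integrable setT (EFin \o psi).
Proof.
move=> cp [B hB]; apply: measurable_bounded_integrable => //.
- by rewrite (le_lt_trans (probability_le1 mu _))// ltry.
- exact: continuous_measurable_fun.
- exists B; split; first by rewrite num_real.
  by move=> y By x _ /=; apply: le_trans (hB x) (ltW By).
Qed.

(** The invariance is about 1-periodic sets only; preimages of Borel sets by a
    periodic function are such sets, so psi and psi o F have the same law. *)
Lemma integral_comp_lift psi : continuous psi -> periodic psi 1 ->
  (\int[mu]_x (psi (F x))%:E = \int[mu]_x (psi x)%:E)%E.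
Proof.
move=> cp pp; have cF : continuous F by exact: F_continuous F_der.
have cpF : continuous (psi \o F) by exact: comp_lift_continuous F_der _ cp.
have ppF : periodic (psi \o F) 1 by exact: comp_lift_per F_lift _ pp.
have mp : measurable_fun [set: measurableTypeR R] (psi : _ -> measurableTypeR R).
  exact: continuous_measurable_fun.
have mpF : measurable_fun [set: measurableTypeR R] (psi \o F : _ -> measurableTypeR R).
  exact: continuous_measurable_fun.
have mE : measurable_fun [set: measurableTypeR R] (@EFin R).
  by apply/measurable_EFinP.
have := @integral_pushforward _ _ _ _ R _ mpF mu setT (@EFin R) mE _ measurableT.
rewrite preimage_setT => <-; last first.
  exact: (prob_integrable cpF (periodic_bounded cpF ppF)).
have := @integral_pushforward _ _ _ _ R _ mp mu setT (@EFin R) mE _ measurableT.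
rewrite preimage_setT => <-; last first.
  exact: (prob_integrable cp (periodic_bounded cp pp)).
apply: eq_measure_integral => A mA _ /=.
rewrite /pushforward comp_preimage; apply: mu_inv.
  by rewrite -[_ @^-1` _]setTI; exact: mp.
by move=> x; rewrite /preimage/= pp.
Qed.

Lemma integral_comp_iter_lift n psi : continuous psi -> periodic psi 1 ->
  (\int[mu]_x (psi (iter n F x))%:E = \int[mu]_x (psi x)%:E)%E.
Proof.
elim: n psi => [//|n IH] psi cp pp.
rewrite -(integral_comp_lift cp pp) -(IH (psi \o F)) //.
- exact: comp_lift_continuous F_der _ cp.
- exact: comp_lift_per F_lift _ pp.
Qed.

Lemma integral_unit_interval psi : continuous psi -> bounded_fct psi ->
  (\int[mu]_x (psi x)%:E = \int[mu]_(x in `[0%R, 1%R]) (psi x)%:E)%E.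
Proof.
move=> cp bp; have mI : measurable (`[0, 1]%classic : set (measurableTypeR R)).
  exact: measurable_itv.
have n0 : mu (~` (`[0, 1]%classic : set (measurableTypeR R))) = 0%E.
  rewrite probability_setC//.
  have -> : mu (`[0, 1]%classic : set (measurableTypeR R)) = 1%E; last by rewrite subee.
  apply/eqP; rewrite eq_le probability_le1//=.
  rewrite -[X in (X <= _)%E]mu_circle; apply: le_measure; rewrite ?inE//.
  by apply: subset_itvl; rewrite bnd_simp.
rewrite (@negligible_integral _ _ _ mu setT (~` `[0, 1]%classic))//; last 2 first.
- exact: measurableC.
- exact: prob_integrable.
by rewrite setTD setCK.
Qed.

Section with_density.
Variable rho : R -> R.
Hypothesis rhoP : is_invariant_density F_lift F_der lam_gt1 dF_lam gam_gt0 dF_holder rho.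

Lemma bholder_of_lipschitz_per k : periodic k 1 ->
  (exists L, forall x y, `|k x - k y| <= L * `|x - y|) -> bholder gam k.
Proof.
move=> pk [L hL]; apply: (bholder_lipschitz gam_gt0 _ _ hL) => //.
by apply: periodic_bounded => //; exact: lipschitz_continuous hL.
Qed.

Lemma equidistribution_integrable psi h : continuous psi -> periodic psi 1 ->
  (@lebesgue_measure R).-integrable `[0, 1] (EFin \o h) ->
  \int[@lebesgue_measure R]_(x in `[0, 1])
     (h x * (psi (iter n F x) - mean (fun x => rho x * psi x))) @[n --> \oo] --> 0.
Proof.
move=> cp pp ih; set c := mean (fun x => rho x * psi x).
have [B hB] := periodic_bounded cp pp.
have ci n : continuous (fun x => psi (iter n F x)).
  exact: comp_iter_lift_continuous F_der n _ cp.
apply: (@weak_cvg_integrable _ (fun n x => psi (iter n F x) - c) (B + `|c|)) => //.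
- by move=> n x; apply: cvgB; [exact: ci|exact: cvg_cst].
- by move=> n x; apply: le_trans (ler_normB _ _) _; rewrite lerD2r.
move=> k pk Lk; have bk := bholder_of_lipschitz_per pk Lk.
have ck : continuous k by exact: holder_cont gam_gt0 _ bk.2.
have := equidistribution rhoP bk pk cp pp; rewrite -/c => hk.
have -> : (fun n => mean (fun x => k x * (psi (iter n F x) - c))) =
  (fun n => mean (fun x => k x * psi (iter n F x)) - mean k * c).
  apply/funext => n; rewrite [mean k * c]mulrC -segintZ// -segintB.
  - by congr segint; apply/funext => x; ring.
  - exact: continuousM_fct.
  - by move=> x; apply: cvgMr; exact: ck.
have : mean (fun x => k x * psi (iter n F x)) - mean k * c @[n --> \oo] -->
    mean k * c - mean k * c by apply: cvgB; [exact: hk|exact: cvg_cst].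
by rewrite subrr.
Qed.

(** Let h be the Lebesgue density of mu.  By invariance the integral of psi is that of
    psi o F^n for every n, i.e. the integral of h (psi o F^n), which tends to the
    mean of rho psi because psi o F^n equidistributes against any integrable
    function. *)
Lemma prob_density psi : continuous psi -> periodic psi 1 ->
  (\int[mu]_x (psi x)%:E = (mean (fun x => rho x * psi x))%:E)%E.
Proof.
move=> cp pp; set c := mean (fun x => rho x * psi x).
have mI : measurable (`[0, 1]%classic : set (measurableTypeR R)).
  exact: measurable_itv.
pose h := Radon_Nikodym (charge_of_finite_measure mu) (@lebesgue_measure R).
have ih : (@lebesgue_measure R).-integrable setT h.
  exact: Radon_Nikodym_integrable.
have fh x : h x \is a fin_num by exact: Radon_Nikodym_fin_num.
have ih1 : (@lebesgue_measure R).-integrable `[0, 1] (EFin \o (fine \o h)).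
  apply: (@eq_integrable _ _ _ _ _ mI h) => [x _|]; first by rewrite /= fineK.
  exact: integrableS ih.
have bp := periodic_bounded cp pp.
have ci n : continuous (fun x => psi (iter n F x)).
  exact: comp_iter_lift_continuous F_der n _ cp.
have pi n : periodic (fun x => psi (iter n F x)) 1.
  exact: comp_iter_lift_per F_lift n _ pp.
have key n : \int[@lebesgue_measure R]_(x in `[0, 1]) (fine (h x) * (psi (iter n F x) - c))
    = fine (\int[mu]_x (psi x)%:E)%E - c.
  have ct : continuous (fun x => psi (iter n F x) - c).
    by move=> x; apply: cvgB; [exact: ci|exact: cvg_cst].
  have pt : periodic (fun x => psi (iter n F x) - c) 1 by move=> x; rewrite pi.
  have bt := periodic_bounded ct pt.
  have e1 : (\int[mu]_x (psi (iter n F x) - c)%:E = \int[mu]_x (psi x)%:E - c%:E)%E.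
    rewrite -(integral_comp_iter_lift n cp pp).
    have := @integralB_EFin _ _ _ mu setT (fun x => psi (iter n F x)) (cst c) measurableT.
    have ec : (\int[mu]_x c%:E = c%:E)%E.
      rewrite integral_cst//; transitivity (c%:E * 1)%E; last exact: mule1.
      by congr (_ * _)%E; exact: probability_setT.
    move=> /= ->; first by rewrite ec.
      exact: (prob_integrable (ci n) (periodic_bounded (ci n) (pi n))).
    apply: (prob_integrable (@cst_continuous _ _ c)).
    by exists `|c|.
  have e2 : (\int[mu]_x (psi (iter n F x) - c)%:E =
      \int[@lebesgue_measure R]_(x in `[0%R, 1%R]) (fine (h x) * (psi (iter n F x) - c))%:E)%E.
    rewrite integral_unit_interval//.
    rewrite -(Radon_Nikodym_change_of_variables mu_ac mI); last first.
      by apply: (integrableS _ _ _ (prob_integrable ct bt)).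
    by apply: eq_integral => x _; rewrite EFinM fineK// muleC.
  rewrite /Rintegral -e2 e1 fineB//.
  by apply: integrable_fin_num => //; exact: prob_integrable.
have := equidistribution_integrable cp pp ih1.
have -> : (fun n => \int[@lebesgue_measure R]_(x in `[0, 1])
     ((fine \o h) x * (psi (iter n F x) - c))) = (fun=> fine (\int[mu]_x (psi x)%:E)%E - c).
  by apply/funext => n; exact: key.
move=> /(cvg_lim (@Rhausdorff R)); rewrite lim_cst// => /eqP.
rewrite subr_eq0 => /eqP <-.
rewrite fineK//.
by apply: integrable_fin_num => //; exact: prob_integrable.
Qed.

End with_density.
End invariant_measure.

(** * The asymptotic variance *)

Section variance.
Context {R : realType}.
Variables (F dF : R -> R) (d : int) (lam gam : R).
Variable mu : probability (measurableTypeR R) R.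
Hypothesis F_lift : forall x, F (x + 1) = F x + d%:~R.
Hypothesis F_der : forall x : R, is_derive x 1 F (dF x).
Hypothesis lam_gt1 : 1 < lam.
Hypothesis dF_lam : forall x, lam <= `|dF x|.
Hypothesis gam_gt0 : 0 < gam.
Hypothesis gam_le1 : gam <= 1.
Hypothesis dF_holder : bholder gam dF.
Hypothesis mu_circle : on_circle mu.
Hypothesis mu_inv : circle_invariant F mu.
Hypothesis mu_ac : mu `<< @lebesgue_measure R.
Variable rho : R -> R.
Hypothesis rhoP : is_invariant_density F_lift F_der lam_gt1 dF_lam gam_gt0 dF_holder rho.
Implicit Types (x y : R) (psi k g : R -> R).

Definition birkhoff psi n x : R := \sum_(0 <= j < n) psi (iter j F x).

Lemma birkhoffSr psi n x : birkhoff psi n.+1 x = birkhoff psi n x + psi (iter n F x).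
Proof. by rewrite /birkhoff big_nat_recr. Qed.

Lemma birkhoffS psi n x : birkhoff psi n.+1 x = psi x + birkhoff psi n (F x).
Proof.
rewrite /birkhoff big_nat_recl//; congr (_ + _); apply: eq_bigr => j _.
by rewrite -iterSr.
Qed.

Lemma birkhoff_continuous psi n : continuous psi -> continuous (birkhoff psi n).
Proof.
move=> cp; elim: n => [|n IH].
  have -> : birkhoff psi 0 = fun=> 0 by apply/funext => x; rewrite /birkhoff big_geq.
  exact: cst_continuous.
have -> : birkhoff psi n.+1 = fun x => birkhoff psi n x + psi (iter n F x).
  by apply/funext => x; rewrite birkhoffSr.
by move=> x; apply: cvgD; [exact: IH|exact: comp_iter_lift_continuous F_der n _ cp _].
Qed.

Lemma birkhoff_per psi n : periodic psi 1 -> periodic (birkhoff psi n) 1.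
Proof.
move=> pp x; apply: eq_bigr => j _.
exact: (comp_iter_lift_per F_lift j pp).
Qed.

Lemma birkhoff_coboundary psi (w m : R -> R) n x :
  (forall x, psi x = m x + w (F x) - w x) ->
  birkhoff psi n x = birkhoff m n x + (w (iter n F x) - w x).
Proof.
move=> h; elim: n => [|n IH].
  by rewrite /birkhoff !big_geq//= add0r subrr.
by rewrite !birkhoffSr IH h iterS; ring.
Qed.

Lemma mean_rho_cst c : mean (fun x => rho x * c) = c.
Proof.
have [_ _ m1 _ _] := rhoP; have cr := rho_continuous rhoP.
have -> : (fun x => rho x * c) = (fun x => c * rho x).
  by apply/funext => x; rewrite mulrC.
by rewrite segintZ// m1 mulr1.
Qed.

Lemma rho_ge0 x : 0 <= rho x.
Proof. by have [_ _ _ [c /ltW c0 hc] _] := rhoP; exact: le_trans (hc x). Qed.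

Lemma sqr_continuous psi : continuous psi -> continuous (fun x => psi x ^+ 2).
Proof. by move=> cp; under eq_fun do rewrite expr2; exact: continuousM_fct. Qed.

(** Pythagoras for martingale differences.  Splitting off the first term of the sum
    leaves a function of F x, which is orthogonal to m, so no double sum occurs. *)
Lemma mean_birkhoff_sq (m : R -> R) n : continuous m -> periodic m 1 ->
  (forall g, continuous g -> periodic g 1 ->
      mean (fun x => rho x * (m x * g (F x))) = 0) ->
  mean (fun x => rho x * birkhoff m n x ^+ 2) = n%:R * mean (fun x => rho x * m x ^+ 2).
Proof.
move=> cm pm orth; have cr := rho_continuous rhoP.
elim: n => [|n IH].
  have -> : (fun x => rho x * birkhoff m 0 x ^+ 2) = fun=> 0.
    by apply/funext => x; rewrite /birkhoff big_geq// expr0n mulr0.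
  by rewrite segint_cst// !mul0r.
have cb := @birkhoff_continuous _ n cm; have pb := @birkhoff_per m n pm.
have -> : (fun x => rho x * birkhoff m n.+1 x ^+ 2) =
  (fun x => rho x * m x ^+ 2 + (2 * (rho x * (m x * birkhoff m n (F x))) +
     rho x * birkhoff m n (F x) ^+ 2)).
  by apply/funext => x; rewrite birkhoffS; ring.
have c1 : continuous (fun x => rho x * m x ^+ 2).
  by apply: continuousM_fct => //; exact: sqr_continuous.
have cbF : continuous (birkhoff m n \o F) by exact: comp_lift_continuous F_der _ cb.
have c2 : continuous (fun x => rho x * (m x * birkhoff m n (F x))).
  by apply: continuousM_fct => //; apply: continuousM_fct.
have c3 : continuous (fun x => rho x * birkhoff m n (F x) ^+ 2).
  by apply: continuousM_fct => //; apply: (sqr_continuous cbF).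
have c2' : continuous (fun x => 2 * (rho x * (m x * birkhoff m n (F x)))).
  by apply: continuousM_fct => //; exact: cst_continuous.
rewrite segintD//; last by move=> x; apply: cvgD; [exact: c2'|exact: c3].
rewrite segintD// segintZ// orth// mulr0 add0r.
rewrite (rho_invariant rhoP (psi := fun x => birkhoff m n x ^+ 2)); last 2 first.
- exact: sqr_continuous.
- by move=> x; rewrite pb.
by rewrite IH -natr1; ring.
Qed.

(** The weighted inequality |2 a b| <= eta a^2 + b^2 / eta replaces Cauchy-Schwarz. *)
Lemma mean_perturbed_sq (A B : R -> R) b eta : continuous A -> continuous B ->
  (forall x, `|B x| <= b) -> 0 < eta ->
  `|mean (fun x => rho x * (A x + B x) ^+ 2) - mean (fun x => rho x * A x ^+ 2)|
    <= eta * mean (fun x => rho x * A x ^+ 2) + (eta^-1 + 1) * b ^+ 2.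
Proof.
move=> cA cB hB e0; have cr := rho_continuous rhoP.
have cAB : continuous (fun x => A x + B x).
  by move=> x; apply: cvgD; [exact: cA|exact: cB].
have c1 : continuous (fun x => rho x * A x ^+ 2).
  by apply: continuousM_fct => //; exact: sqr_continuous.
have c2 : continuous (fun x => rho x * (A x + B x) ^+ 2).
  by apply: continuousM_fct => //; exact: sqr_continuous.
pose K := (eta^-1 + 1) * b ^+ 2.
have pw x : `|(A x + B x) ^+ 2 - A x ^+ 2| <= eta * A x ^+ 2 + K.
  have Bb : B x ^+ 2 <= b ^+ 2.
    by rewrite -[B x ^+ 2]real_normK ?num_real// ler_sqr ?nnegrE// (le_trans _ (hB x)).
  have ei : 0 < eta^-1 by rewrite invr_gt0.
  have h1 : eta^-1 * B x ^+ 2 <= eta^-1 * b ^+ 2 by rewrite ler_wpM2l// ltW.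
  have sq1 := mulr_ge0 (ltW ei) (sqr_ge0 (eta * A x - B x)).
  have sq2 := mulr_ge0 (ltW ei) (sqr_ge0 (eta * A x + B x)).
  have e1 : eta^-1 * (eta * A x - B x) ^+ 2 =
    eta * A x ^+ 2 - 2 * (A x * B x) + eta^-1 * B x ^+ 2.
    by field; rewrite gt_eqF.
  have e2 : eta^-1 * (eta * A x + B x) ^+ 2 =
    eta * A x ^+ 2 + 2 * (A x * B x) + eta^-1 * B x ^+ 2.
    by field; rewrite gt_eqF.
  rewrite e1 in sq1; rewrite e2 in sq2.
  have -> : (A x + B x) ^+ 2 - A x ^+ 2 = 2 * (A x * B x) + B x ^+ 2 by ring.
  have B0 := sqr_ge0 (B x).
  rewrite /K mulrDl mul1r ler_norml; apply/andP; split; lra.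
have c3 : continuous (fun x => eta * (rho x * A x ^+ 2)).
  by apply: continuousM_fct => //; exact: cst_continuous.
have c4 : continuous (fun x => rho x * K).
  by apply: continuousM_fct => //; exact: cst_continuous.
have e3 : eta * mean (fun x => rho x * A x ^+ 2) + K =
   mean (fun x => eta * (rho x * A x ^+ 2) + rho x * K).
  by rewrite segintD// segintZ// mean_rho_cst.
have e4 : mean (fun x => rho x * (A x + B x) ^+ 2) - mean (fun x => rho x * A x ^+ 2) =
   mean (fun x => rho x * (A x + B x) ^+ 2 - rho x * A x ^+ 2) by rewrite segintB.
rewrite e4 -/K e3 ler_norml; apply/andP; split.
  rewrite -mulN1r -segintZ; last by move=> x; apply: cvgD; [exact: c3|exact: c4].
  apply: le_segint => [x|x|x _]; first apply: cvgMr; first apply: cvgD;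
    [exact: c3|exact: c4|apply: cvgB; [exact: c2|exact: c1]|].
  have := pw x; rewrite ler_norml => /andP[+ _] => /(ler_wpM2l (rho_ge0 x)).
  by set a := A x; set ab := (a + B x) ^+ 2; nra.
apply: le_segint => [x|x|x _].
- by apply: cvgB; [exact: c2|exact: c1].
- by apply: cvgD; [exact: c3|exact: c4].
have := pw x; rewrite ler_norml => /andP[_] => /(ler_wpM2l (rho_ge0 x)).
by set a := A x; set ab := (a + B x) ^+ 2; nra.
Qed.

(** The Birkhoff sums of psi and m differ by a bounded function.  That the limit
    exists is part of the claim: the limit of a divergent sequence has by convention
    a default value, which is 0 here. *)
Lemma variance_cvg psi (w m : R -> R) : continuous psi -> periodic psi 1 ->
  continuous w -> periodic w 1 -> continuous m -> periodic m 1 ->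
  (forall x, psi x = m x + w (F x) - w x) ->
  (forall g, continuous g -> periodic g 1 ->
      mean (fun x => rho x * (m x * g (F x))) = 0) ->
  asymptotic_variance F psi mu = (mean (fun x => rho x * m x ^+ 2))%:E.
Proof.
move=> cp pp cw pw cm pm hdec orth; set tau := mean _.
have cr := rho_continuous rhoP.
have tau0 : 0 <= tau.
  by apply: Rintegral_ge0 => x _; rewrite mulr_ge0 ?rho_ge0 ?sqr_ge0.
pose Q n := n%:R^-1 * mean (fun x => rho x * birkhoff psi n.+1 x ^+ 2).
have QE n : (\int[mu]_x (((\sum_(0 <= j < n.+1) psi (iter j F x)) / Num.sqrt n%:R) ^+ 2)%:E)%E
    = (Q n)%:E.
  have cb := @birkhoff_continuous _ n.+1 cp; have pb := @birkhoff_per psi n.+1 pp.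
  have e : (fun x => (\sum_(0 <= j < n.+1) psi (iter j F x)) / Num.sqrt n%:R) =
    fun x => birkhoff psi n.+1 x * (Num.sqrt n%:R)^-1 by [].
  have cb2 : continuous (fun x => (birkhoff psi n.+1 x * (Num.sqrt n%:R)^-1) ^+ 2).
    by apply: sqr_continuous; apply: continuousM_fct => //; exact: cst_continuous.
  rewrite (prob_density gam_le1 mu_circle mu_inv mu_ac rhoP cb2); last by move=> x; rewrite pb.
  congr EFin; rewrite /Q -segintZ; last by apply: continuousM_fct => //; exact: sqr_continuous.
  congr segint; apply/funext => x.
  by rewrite exprMn exprVn sqr_sqrtr//; ring.
suff cQ : Q n @[n --> \oo] --> tau.
  rewrite /asymptotic_variance; under eq_fun do rewrite QE.
  by apply/cvg_lim => //; apply: cvg_EFin => //; near=> n.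
have [b hb] := periodic_bounded cw pw.
pose B n x := w (iter n.+1 F x) - w x.
have cB n : continuous (B n).
  move=> x; apply: cvgB; last exact: cw.
  exact: comp_iter_lift_continuous F_der n.+1 _ cw _.
have hB n x : `|B n x| <= b + b by apply: le_trans (ler_normB _ _) _; exact: lerD.
apply/cvgrPdist_le => e e0.
(* eta makes the error proportional to tau at most e / 2 for n >= 1, and K / n is
   at most e / 2 for n large *)
pose eta := e / (4 * (tau + 1)); have eta0 : 0 < eta by rewrite divr_gt0// mulr_gt0//; lra.
pose K := tau + (eta^-1 + 1) * (b + b) ^+ 2.
near=> n.
have n0 : (0 < n)%N by near: n; exact: nbhs_infty_gt.
have n0R : 0 < n%:R :> R by rewrite ltr0n.
have nK : K / (e / 2) <= n%:R by near: n; exact: nbhs_infty_ger.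
have cbm := @birkhoff_continuous _ n.+1 cm.
have h := mean_perturbed_sq cbm (cB n) (hB n) eta0.
rewrite mean_birkhoff_sq// -/tau in h.
have e1 : Q n = n%:R^-1 * mean (fun x => rho x * (birkhoff m n.+1 x + B n x) ^+ 2).
  rewrite /Q; congr (_ * segint _ _ _); apply/funext => x.
  by rewrite (birkhoff_coboundary n.+1 x hdec).
rewrite distrC e1; move: h; set M := mean _ => h.
have -> : n%:R^-1 * M - tau = n%:R^-1 * ((M - n.+1%:R * tau) + tau).
  by rewrite -natr1; field; rewrite gt_eqF.
rewrite normrM ger0_norm ?invr_ge0 ?(ltW n0R)// mulrC ler_pdivrMr//.
have n1 : 1 <= n%:R :> R by rewrite ler1n.
have hM : `|M - n.+1%:R * tau + tau| <= eta * (n.+1%:R * tau) + K.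
  apply: le_trans (ler_normD _ _) _; rewrite (ger0_norm tau0) /K.
  by rewrite [tau + _]addrC addrA lerD2r.
apply: le_trans hM _.
have nK' : K <= n%:R * (e / 2) by rewrite -ler_pdivrMr// divr_gt0.
have : eta * (n.+1%:R * tau) <= n%:R * (e / 2).
  have -> : eta * (n.+1%:R * tau) = n.+1%:R / 2 * (tau / (tau + 1)) * (e / 2).
    by rewrite /eta; field; lra.
  rewrite ler_wpM2r ?divr_ge0 ?(ltW e0)//.
  apply: (@le_trans _ _ (n.+1%:R / 2)).
    by rewrite ler_piMr ?divr_ge0// ler_pdivrMr; lra.
  by rewrite -natr1 ler_pdivrMr//; lra.
by lra.
Unshelve. all: by end_near. Qed.

(** The variance is the mean of rho m^2, where rho is bounded below and m is
    continuous, so it vanishes only if m = 0 everywhere. *)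
Lemma zero_variance_coboundary psi : bholder gam psi -> periodic psi 1 ->
    mean (fun x => rho x * psi x) = 0 -> sigma F psi mu = 0%E ->
  exists w, [/\ bholder gam w, periodic w 1 & forall x, psi x = w (F x) - w x].
Proof.
move=> bp pp m0 s0.
have [w [m [bw pw bm pm [hdec orth]]]] := martingale_decomposition rhoP bp pp m0.
have cp : continuous psi by exact: holder_cont gam_gt0 _ bp.2.
have cw : continuous w by exact: holder_cont gam_gt0 _ bw.2.
have cm : continuous m by exact: holder_cont gam_gt0 _ bm.2.
have := s0; rewrite /sigma (variance_cvg cp pp cw pw cm pm hdec orth) /=.
move=> [/eqP]; rewrite sqrtr_eq0 => t0.
have cr := rho_continuous rhoP.
have z : forall x, rho x * m x ^+ 2 = 0.
  apply: mean_eq0.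
  - by apply: continuousM_fct => //; exact: sqr_continuous.
  - by move=> x; rewrite (rho_per rhoP) pm.
  - by move=> x; rewrite mulr_ge0 ?rho_ge0 ?sqr_ge0.
  - apply/eqP; rewrite eq_le t0/=.
    by apply: Rintegral_ge0 => x _; rewrite mulr_ge0 ?rho_ge0 ?sqr_ge0.
exists w; split=> // x; rewrite hdec.
have [_ _ _ [c c0 hc] _] := rhoP.
have := z x => /eqP; rewrite mulf_eq0 gt_eqF ?(lt_le_trans c0)//= sqrf_eq0 => /eqP ->.
by rewrite add0r.
Qed.

(** The Birkhoff sums telescope to bounded functions. *)
Lemma coboundary_zero_variance psi (u : R -> R) : continuous psi -> periodic psi 1 ->
  bounded_fct u -> (forall x, psi x = u x - u (F x)) -> sigma F psi mu = 0%E.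
Proof.
move=> cp pp [b hb] h.
rewrite /sigma; suff -> : asymptotic_variance F psi mu = 0%E by rewrite /= sqrtr0.
have tele n x : birkhoff psi n x = u x - u (iter n F x).
  elim: n => [|n IH]; first by rewrite /birkhoff big_geq// subrr.
  by rewrite birkhoffSr IH h iterS; ring.
apply/cvg_lim => //.
have b0 : 0 <= b by apply: le_trans (hb 0).
have bound (n : nat) : (0 <= \int[mu]_x
    (((\sum_(0 <= j < n.+1) psi (iter j F x)) / Num.sqrt n%:R) ^+ 2)%:E
    <= ((2 * b) ^+ 2 * n%:R^-1)%:E)%E.
  have cb := @birkhoff_continuous _ n.+1 cp.
  have cb2 : continuous (fun x => (birkhoff psi n.+1 x * (Num.sqrt n%:R)^-1) ^+ 2).
    by apply: sqr_continuous; apply: continuousM_fct => //; exact: cst_continuous.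
  apply/andP; split; first by apply: integral_ge0 => x _; rewrite lee_fin sqr_ge0.
  have -> : ((2 * b) ^+ 2 * n%:R^-1)%:E = (\int[mu]_x ((2 * b) ^+ 2 * n%:R^-1)%:E)%E.
    rewrite integral_cst//; transitivity (((2 * b) ^+ 2 * n%:R^-1)%:E * 1)%E; first by rewrite mule1.
    by congr (_ * _)%E; rewrite -[LHS](probability_setT mu).
  apply: ge0_le_integral => //.
  - by move=> x _; rewrite lee_fin sqr_ge0.
  - by apply/measurable_EFinP; exact: continuous_measurable_fun.
  move=> x _; rewrite lee_fin expr_div_n sqr_sqrtr// ler_wpM2r ?invr_ge0//.
  rewrite -/(birkhoff psi n.+1 x) tele -[leLHS]real_normK ?num_real//.
  rewrite ler_sqr ?nnegrE ?mulr_ge0//; apply: le_trans (ler_normB _ _) _.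
  by have := hb x; have := hb (iter n.+1 F x); lra.
apply: (@squeeze_cvge _ _ _ _ (fun=> 0%E) _ (fun n => ((2 * b) ^+ 2 * n%:R^-1)%:E)).
- by near=> n.
- exact: cvg_cst.
- apply: cvg_EFin; first by near=> n.
  rewrite -[X in _ --> X](mulr0 ((2 * b) ^+ 2)); apply: cvgMr.
  rewrite -(cvg_shiftS (fun n => n%:R^-1 : R)); exact: cvg_harmonic.
Unshelve. all: by end_near. Qed.

End variance.

(** * The generalized Weierstrass function *)

Section weierstrass_function.
Context {R : realType}.
Variables (F dF ddF v dv : R -> R) (d : int) (lam : R).
Hypothesis F_lift : forall x, F (x + 1) = F x + d%:~R.
Hypothesis F_der : forall x : R, is_derive x 1 F (dF x).
Hypothesis dF_der : forall x : R, is_derive x 1 dF (ddF x).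
Hypothesis v_der : forall x : R, is_derive x 1 v (dv x).
Hypothesis lam_gt1 : 1 < lam.
Hypothesis dF_lam : forall x, lam <= `|dF x|.
Hypothesis dF_per : periodic dF 1.
Hypothesis ddF_per : periodic ddF 1.
Hypothesis ddF_cont : continuous ddF.
Hypothesis v_per : periodic v 1.
Hypothesis dv_per : periodic dv 1.
Hypothesis dv_cont : continuous dv.
Implicit Types (x y : R) (n k : nat).

Let kap := lam^-1.

(** The partial sums of the series, as iterates of the contraction
    beta |-> (beta o F - v) / F' applied to 0. *)
Fixpoint approx n x : R :=
  if n is n'.+1 then (approx n' (F x) - v x) / dF x else 0.

Let dF0 x : dF x != 0.
Proof. by rewrite -normr_gt0 (lt_le_trans _ (dF_lam x))// (lt_trans ltr01). Qed.

Let kap_itv : 0 <= kap < 1.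
Proof.
have l0 := lt_trans ltr01 lam_gt1.
by rewrite /kap invr_ge0 (ltW l0) invf_lt1.
Qed.

Let dFV x : `|(dF x)^-1| <= kap.
Proof. by rewrite normfV lef_pV2 ?posrE ?normr_gt0// (lt_trans ltr01 lam_gt1). Qed.

Let cF : continuous F. Proof. exact: is_derive_continuous F_der. Qed.
Let cdF : continuous dF. Proof. exact: is_derive_continuous dF_der. Qed.
Let cv : continuous v. Proof. exact: is_derive_continuous v_der. Qed.

Lemma iter_derivable n x : derivable (iter n F) x 1.
Proof.
elim: n x => [|n IH] x; first exact: derivable_id.
have -> : iter n.+1 F = iter n F \o F by apply/funext => y; rewrite iterSr.
by have [] := is_derive1_comp (derive1_is_derive (IH (F x))) (F_der x).
Qed.

Lemma derive1_iterS n x : derive1 (iter n.+1 F) x = derive1 (iter n F) (F x) * dF x.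
Proof.
have -> : iter n.+1 F = iter n F \o F by apply/funext => y; rewrite iterSr.
have h := is_derive1_comp (derive1_is_derive (@iter_derivable n (F x))) (F_der x).
exact: is_derive_derive1 h.
Qed.

Lemma approxE n x :
  \sum_(1 <= k < n.+1) v (iter k.-1 F x) / derive1 (iter k F) x = - approx n x.
Proof.
elim: n x => [|n IH] x; first by rewrite big_geq// oppr0.
rewrite big_add1/= big_nat_recl//=.
have -> : derive1 (iter 1 F) x = dF x by exact: is_derive_derive1.
have -> : \sum_(0 <= i < n) v (iter i.+1 F x) / derive1 (iter i.+2 F) x =
   (dF x)^-1 * \sum_(1 <= k < n.+1) v (iter k.-1 F (F x)) / derive1 (iter k F) (F x).
  rewrite big_add1/= mulr_sumr; apply: eq_bigr => i _.
  have -> : F (iter i F x) = iter i F (F x) by rewrite -iterS iterSr.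
  by rewrite (derive1_iterS i.+1) invfM; ring.
by rewrite IH; field; exact: dF0.
Qed.

Lemma approx_step : exists2 C, 0 <= C &
  forall n x, `|approx n.+1 x - approx n x| <= C * kap ^+ n.
Proof.
have [V hV] := periodic_bounded cv v_per.
have V0 : 0 <= V by apply: le_trans (hV 0).
have /andP[k0 k1] := kap_itv.
exists (V * kap); first by rewrite mulr_ge0.
elim=> [|n IH] x.
  by rewrite /= sub0r subr0 expr0 mulr1 normrM normrN; exact: ler_pM.
have -> : approx n.+2 x - approx n.+1 x =
   (approx n.+1 (F x) - approx n (F x)) * (dF x)^-1 by rewrite /=; ring.
by rewrite normrM exprSr mulrA; apply: ler_pM.
Qed.

Lemma weierstrass_approx : exists2 C, 0 <= C &
  forall n x, `|weierstrass F v x - approx n x| <= C * kap ^+ n.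
Proof.
have [C C0 hC] := approx_step; have /andP[k0 k1] := kap_itv.
exists (C / (1 - kap)); first by rewrite divr_ge0// subr_ge0 ltW.
move=> n x; have [cA hA] := geometric_cvg kap_itv (hC^~ x).
suff -> : weierstrass F v x = limn (approx^~ x) by exact: hA.
rewrite /weierstrass; set u := (X in limn X).
have : u N @[N --> \oo] --> - limn (approx^~ x).
  rewrite -(cvg_shiftS u).
  have -> : (fun N => u N.+1) = (fun N => - approx N x).
    by apply/funext => N; exact: approxE.
  exact: cvgN.
by move/(cvg_lim (@Rhausdorff R)) ->; rewrite opprK.
Qed.

(* A function approximated by the partial sums at a geometric rate; it is kept
   abstract so that its defining series is never unfolded. *)
Variable alpha : R -> R.
Hypothesis approx_cvg : exists2 C, 0 <= C &
  forall n x, `|alpha x - approx n x| <= C * kap ^+ n.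

Lemma weierstrass_eq x : alpha (F x) = v x + dF x * alpha x.
Proof.
have [C C0 hC] := approx_cvg; have /andP[k0 k1] := kap_itv.
apply/eqP; rewrite -subr_eq0; apply/eqP.
apply: (@geometric_eq0 _ _ (C + `|dF x| * C) kap kap_itv) => n.
have e : approx n (F x) = v x + dF x * approx n.+1 x.
  by rewrite /=; field; exact: dF0.
have -> : alpha (F x) - (v x + dF x * alpha x) =
  (alpha (F x) - approx n (F x)) - dF x * (alpha x - approx n.+1 x) by rewrite e; ring.
apply: le_trans (ler_normB _ _) _; rewrite mulrDl; apply: lerD; first exact: hC.
rewrite normrM -mulrA ler_wpM2l//; apply: le_trans (hC _ _) _.
by rewrite ler_wpM2l// exprS ler_piMl ?exprn_ge0// ltW.
Qed.

Lemma approx_per n : periodic (approx n) 1.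
Proof.
elim: n => [//|n IH] x /=.
by rewrite F_lift periodic_int// v_per dF_per.
Qed.

Lemma weierstrass_per : periodic alpha 1.
Proof.
have [C C0 hC] := approx_cvg => x.
apply/eqP; rewrite -subr_eq0; apply/eqP.
apply: (@geometric_eq0 _ _ (C + C) kap kap_itv) => n.
have -> : alpha (x + 1) - alpha x =
    (alpha (x + 1) - approx n (x + 1)) - (alpha x - approx n x).
  by rewrite approx_per; ring.
by apply: le_trans (ler_normB _ _) _; rewrite mulrDl; exact: lerD.
Qed.

Lemma approx_bounded : exists2 B, 0 <= B & forall n x, `|approx n x| <= B.
Proof.
have [V hV] := periodic_bounded cv v_per.
have V0 : 0 <= V by apply: le_trans (hV 0).
have /andP[k0 k1] := kap_itv.
have k2 : 0 < 1 - kap by rewrite subr_gt0.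
exists (V / (1 - kap)); first by rewrite divr_ge0// ltW.
elim=> [|n IH] x; first by rewrite /= normr0 divr_ge0// ltW.
rewrite /= normrM.
apply: (@le_trans _ _ ((V / (1 - kap) + V) * kap)).
  apply: ler_pM => //; apply: le_trans (ler_normB _ _) _; exact: lerD.
rewrite -subr_ge0.
have -> : V / (1 - kap) - (V / (1 - kap) + V) * kap = V * (1 - kap).
  by field; rewrite gt_eqF.
by rewrite mulr_ge0// ltW.
Qed.

Lemma weierstrass_bounded : bounded_fct alpha.
Proof.
have [C C0 hC] := approx_cvg; exists C => x.
by have := hC 0%N x; rewrite /= subr0 expr0 mulr1.
Qed.

(** Composition with F multiplies a Hoelder constant by at most M ^ gam, and the
    division by F' gains the factor 1 / lam: if M ^ gam < lam the constants of the
    partial sums stay bounded.  This covers small exponents gam only. *)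
Lemma weierstrass_bholder (gam M : R) : 0 < gam -> bholder gam v ->
  bholder gam dF -> 0 <= M -> (forall x y, `|F x - F y| <= M * `|x - y|) ->
  M `^ gam < lam -> bholder gam alpha.
Proof.
move=> g0 bv bdF M0 hM Mlam; split; first exact: weierstrass_bounded.
have l0 := lt_trans ltr01 lam_gt1.
have /andP[k0 k1] := kap_itv.
have bV : bholder gam (fun x => (dF x)^-1) by exact: bholderV l0 dF_lam bdF.
have [C1 C10 h1] := holder_ge0 bV.2; have [C2 C20 h2] := holder_ge0 bv.2.
have [V hV] := bv.1; have V0 : 0 <= V by apply: le_trans (hV 0).
have [B B0 hB] := approx_bounded.
pose q := M `^ gam * kap.
have q1 : q < 1 by rewrite /q ltr_pdivrMr// mul1r.
have q2 : 0 < 1 - q by rewrite subr_gt0.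
pose H := ((B + V) * C1 + C2 * kap) / (1 - q).
have H0 : 0 <= H.
  by rewrite divr_ge0 ?(ltW q2)// addr_ge0// mulr_ge0// addr_ge0.
have HE : (B + V) * C1 + (H * M `^ gam + C2) * kap = H.
  have -> : (B + V) * C1 + (H * M `^ gam + C2) * kap =
    (B + V) * C1 + C2 * kap + H * q by rewrite /q; ring.
  by rewrite /H; field; rewrite gt_eqF.
clearbody H.
have hH n x y : `|approx n x - approx n y| <= H * `|x - y| `^ gam.
  elim: n x y => [|n IH] x y.
    by rewrite /= subrr normr0 mulr_ge0 ?powR_ge0.
  have -> : approx n.+1 x - approx n.+1 y =
    (approx n (F x) - v x) * ((dF x)^-1 - (dF y)^-1) +
    ((approx n (F x) - approx n (F y)) - (v x - v y)) * (dF y)^-1 by rewrite /=; ring.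
  rewrite -HE [leRHS]mulrDl; apply: le_trans (ler_normD _ _) _; apply: lerD.
    rewrite normrM -mulrA; apply: ler_pM => //.
    by apply: le_trans (ler_normB _ _) _; exact: lerD.
  rewrite normrM mulrAC; apply: ler_pM => //.
  rewrite mulrDl; apply: le_trans (ler_normB _ _) _; apply: lerD => //.
  apply: le_trans (IH _ _) _; rewrite -mulrA; apply: ler_wpM2l => //; rewrite -powRM//.
  by apply: ge0_ler_powR; rewrite ?nnegrE ?mulr_ge0// ltW.
have [C C0 hC] := approx_cvg.
exists H => x y; apply: (@ler_geometricD _ _ _ (C + C) kap kap_itv) => n.
have -> : alpha x - alpha y = (approx n x - approx n y) +
   ((alpha x - approx n x) - (alpha y - approx n y)) by ring.
apply: le_trans (ler_normD _ _) _; apply: lerD => //.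
by apply: le_trans (ler_normB _ _) _; rewrite mulrDl; exact: lerD.
Qed.

(** The derivatives of the partial sums are not Birkhoff sums of phi, but of its
    approximations approx_phi n, which converge to phi geometrically. *)
Definition approx_phi n x : R := - ((dv x + approx n x * ddF x) / dF x).

Fixpoint dapprox n x : R :=
  if n is n'.+1 then dapprox n' (F x) + approx_phi n'.+1 x else 0.

Lemma approx_derive n x : is_derive x 1 (approx n) (dapprox n x).
Proof.
elim: n x => [|n IH] x; first exact: is_derive_cst.
have h1 := is_derive1_comp (IH (F x)) (F_der x).
have h2 := is_deriveB h1 (v_der x).
have h3 := is_deriveV (dF0 x) (dF_der x).
have h4 := is_deriveM h2 h3.
apply: (@is_derive_eq _ _ _ (approx n.+1) _ _ _ _ h4); rewrite /= /approx_phi /GRing.scale/=.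
transitivity ((approx n (F x) - v x) * (- dF x ^- 2 * ddF x) +
  (dF x)^-1 * (dapprox n (F x) * dF x - dv x)); first by [].
by field; exact: dF0.
Qed.

Lemma approx_continuous n : continuous (approx n).
Proof. exact: is_derive_continuous (approx_derive n). Qed.

Let cdFV : continuous (fun x => (dF x)^-1).
Proof. by move=> x; apply: cvgV; [exact: dF0|exact: cdF]. Qed.

Lemma approx_phi_continuous n : continuous (approx_phi n).
Proof.
move=> x; apply: cvgN; apply: cvgM; last exact: cdFV.
by apply: cvgD; [exact: dv_cont|apply: cvgM; [exact: approx_continuous|exact: ddF_cont]].
Qed.

Lemma dapprox_continuous n : continuous (dapprox n).
Proof.
elim: n => [|n IH]; first exact: cst_continuous.
move=> x /=; apply: cvgD; last exact: approx_phi_continuous.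
by apply: (@continuous_comp _ _ _ F (dapprox n)); [exact: cF|exact: IH].
Qed.

Lemma dapprox_per n : periodic (dapprox n) 1.
Proof.
elim: n => [//|n IH] x; rewrite [LHS]/= F_lift periodic_int//.
by rewrite /approx_phi dv_per approx_per ddF_per dF_per.
Qed.

Local Notation phi := (fun x => - ((dv x + alpha x * ddF x) / dF x)).

Lemma approx_phi_cvg : exists2 C, 0 <= C &
  forall n x, `|approx_phi n x - phi x| <= C * kap ^+ n.
Proof.
have [C C0 hC] := approx_cvg; have [B hB] := periodic_bounded ddF_cont ddF_per.
have B0 : 0 <= B by apply: le_trans (hB 0).
have /andP[k0 k1] := kap_itv.
exists (C * B * kap); first by rewrite !mulr_ge0.
move=> n x; have -> : approx_phi n x - phi x =
   (alpha x - approx n x) * ddF x * (dF x)^-1 by rewrite /approx_phi; ring.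
rewrite !normrM (_ : C * B * kap * kap ^+ n = C * kap ^+ n * B * kap); last by ring.
by rewrite ler_pM ?mulr_ge0//; apply: ler_pM.
Qed.

Lemma weierstrass_continuous : continuous alpha.
Proof.
have [C C0 hC] := approx_cvg; have /andP[k0 k1] := kap_itv.
move=> x; apply/cvgrPdist_le => e e0.
have e3 : 0 < e / 3 by rewrite divr_gt0.
have : C * kap ^+ n @[n --> \oo] --> C * 0.
  by apply: cvgMr; apply: cvg_expr; rewrite ger0_norm.
rewrite mulr0 => /cvgrPdist_le/(_ _ e3)[N _ /(_ N (leqnn _))].
rewrite /= sub0r normrN => /(le_trans (ler_norm _)) hN.
have /cvgrPdist_le/(_ _ e3) := @approx_continuous N x; apply: filterS => y hy.
have -> : alpha x - alpha y = (alpha x - approx N x) +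
   ((approx N x - approx N y) - (alpha y - approx N y)) by ring.
apply: le_trans (ler_normD _ _) _.
have h1 := hC N x; have h2 := hC N y.
have h3 := ler_normB (approx N x - approx N y) (alpha y - approx N y).
by lra.
Qed.

Lemma phi_continuous : continuous phi.
Proof.
move=> x; apply: cvgN; apply: cvgM; last exact: cdFV.
by apply: cvgD; [exact: dv_cont|apply: cvgM; [exact: weierstrass_continuous|exact: ddF_cont]].
Qed.

Lemma phi_per : periodic phi 1.
Proof. by move=> x; rewrite dv_per weierstrass_per ddF_per dF_per. Qed.

Lemma dapprox_birkhoff : exists C, forall n x, `|birkhoff F phi n x - dapprox n x| <= C.
Proof.
have [C C0 hC] := approx_phi_cvg; have /andP[k0 k1] := kap_itv.
have k2 : 0 < 1 - kap by rewrite subr_gt0.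
exists (C / (1 - kap)) => n x.
have : `|birkhoff F phi n x - dapprox n x| <= C / (1 - kap) * (1 - kap ^+ n).
  elim: n x => [|n IH] x.
    by rewrite /birkhoff big_geq// subrr normr0 expr0 subrr mulr0.
  rewrite birkhoffS [dapprox _ _]/=.
  have -> : C / (1 - kap) * (1 - kap ^+ n.+1) =
      C / (1 - kap) * (1 - kap ^+ n) + C * kap ^+ n.
    by rewrite exprS; field; rewrite gt_eqF.
  have -> : phi x + birkhoff F phi n (F x) - (dapprox n (F x) + approx_phi n.+1 x) =
    (birkhoff F phi n (F x) - dapprox n (F x)) - (approx_phi n.+1 x - phi x) by ring.
  apply: le_trans (ler_normB _ _) _; apply: lerD => //.
  apply: le_trans (hC _ _) _; rewrite ler_wpM2l// exprS ler_piMl ?exprn_ge0//.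
  exact: ltW.
move/le_trans; apply; rewrite ler_piMr ?divr_ge0 ?(ltW k2)// gerBl.
exact: exprn_ge0.
Qed.

Section invariant.
Variable gam : R.
Hypothesis gam_gt0 : 0 < gam.
Hypothesis gam_le1 : gam <= 1.
Hypothesis dF_holder : bholder gam dF.
Variable rho : R -> R.
Hypothesis rhoP : is_invariant_density F_lift F_der lam_gt1 dF_lam gam_gt0 dF_holder rho.

Lemma mean_dapprox n : mean (dapprox n) = 0.
Proof.
rewrite (segintE (@dapprox_continuous n) (approx_derive n) ler01).
by rewrite -[X in approx n X - _](add0r 1) approx_per subrr.
Qed.

(** The derivative of a periodic partial sum has mean 0, so the means of the Birkhoff
    sums of phi are bounded; their averages tend to the mean of rho phi by
    equidistribution and Cesaro. *)
Lemma mean_phi0 : mean (fun x => rho x * phi x) = 0.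
Proof.
have [C hC] := dapprox_birkhoff; set c := mean _.
pose u j := mean (fun x => phi (iter j F x)).
have cphi := phi_continuous; have pphi := phi_per.
have ci j : continuous (fun x => phi (iter j F x)).
  exact: (@comp_iter_lift_continuous _ F dF F_der j phi cphi).
have uc : u n @[n --> \oo] --> c.
  have k1 : bholder gam (fun _ : R => 1) by exact: bholder_cst.
  have p1 : periodic (fun _ : R => 1 : R) 1 by [].
  have := equidistribution rhoP k1 p1 cphi pphi.
  rewrite segint_cst// subr0 !mul1r -/c.
  have -> // : (fun n => mean (fun x => 1 * phi (iter n F x))) = u.
  by apply/funext => n; congr segint; apply/funext => x; rewrite mul1r.
have cb n : continuous (birkhoff F phi n).
  exact: (@birkhoff_continuous _ F dF F_der phi n cphi).
have su n : series u n = mean (birkhoff F phi n).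
  rewrite /series/=; elim: n => [|n IH].
    rewrite big_geq// (_ : birkhoff F phi 0 = fun=> 0) ?segint_cst ?mul0r//.
    by apply/funext => x; rewrite /birkhoff big_geq.
  rewrite big_nat_recr//= IH -segintD//.
  by congr segint; apply/funext => x; rewrite birkhoffSr.
have sb n : `|series u n| <= C.
  have cda := @dapprox_continuous n.
  have -> : series u n = mean (fun x => birkhoff F phi n x - dapprox n x).
    by rewrite segintB// mean_dapprox subr0 su.
  apply: (@le_trans _ _ (C * (1 - 0))); last by rewrite subr0 mulr1.
  apply: segint_norm_le => //.
  by move=> x; apply: cvgB; [exact: cb|exact: cda].
have C0 : 0 <= C by apply: le_trans (sb 0%N).
have z : arithmetic_mean u n @[n --> \oo] --> 0.
  apply/cvgrPdist_le => e e0.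
  have : C * harmonic n @[n --> \oo] --> C * 0 by apply: cvgMr; exact: cvg_harmonic.
  rewrite mulr0 => /cvgrPdist_le/(_ e e0); apply: filterS => n.
  rewrite !sub0r !normrN; apply: le_trans.
  rewrite /arithmetic_mean/= normrM mulrC [leRHS]normrM (ger0_norm C0).
  by rewrite ler_wpM2r.
have := cesaro uc => /(cvg_lim (@Rhausdorff R)) <-.
exact: cvg_lim z.
Qed.

(** Formally the derivative of alpha is u up to an F-invariant distribution, which
    must be constant.  The concrete form: beta n, the derivative of the n-th partial
    sum minus u, satisfies beta (K + n) = beta K o F^n up to an error of order
    lam^-K.  For fixed K and n to infinity, the integral of beta K o F^n over [0, y]
    tends to c K * y; hence alpha - U has increments linear up to an error of order
    lam^-K, for every K. *)
Lemma weierstrass_primitive (u U : R -> R) : continuous u -> periodic u 1 ->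
    (forall x, phi x = u x - u (F x)) -> (forall x, is_derive x 1 U (u x)) ->
  exists c, forall x, alpha x = alpha 0 + (U x - U 0) + c * x.
Proof.
move=> cu pu hu dU.
have [C C0 hC] := approx_phi_cvg; have [C1 C10 hC1] := approx_cvg.
have /andP[k0 k1] := kap_itv.
have k2 : 0 < 1 - kap by rewrite subr_gt0.
pose beta n x := dapprox n x - u x.
have cbeta n : continuous (beta n).
  by move=> x; apply: cvgB; [exact: dapprox_continuous|exact: cu].
have pbeta n : periodic (beta n) 1 by move=> x; rewrite /beta dapprox_per pu.
have betaS n x : beta n.+1 x = beta n (F x) + (approx_phi n.+1 x - phi x).
  by rewrite /beta /= hu; ring.
pose C2 := C / (1 - kap).
have C20 : 0 <= C2 by rewrite divr_ge0// ltW.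
have bd K n x : `|beta (K + n)%N x - beta K (iter n F x)| <= C2 * kap ^+ K.
  have : `|beta (K + n)%N x - beta K (iter n F x)| <= C2 * kap ^+ K * (1 - kap ^+ n).
    elim: n x => [|n IH] x.
      by rewrite addn0 subrr normr0 expr0 subrr mulr0.
    rewrite addnS betaS iterSr.
    have -> : C2 * kap ^+ K * (1 - kap ^+ n.+1) =
        C2 * kap ^+ K * (1 - kap ^+ n) + C * kap ^+ (K + n).
      by rewrite /C2 exprS exprD; field; rewrite gt_eqF.
    rewrite addrAC; apply: le_trans (ler_normD _ _) _; apply: lerD => //.
    apply: le_trans (hC _ _) _; rewrite ler_wpM2l// exprS ler_piMl ?exprn_ge0//.
    exact: ltW.
  move/le_trans; apply; rewrite (ler_piMr (mulr_ge0 C20 (exprn_ge0 K k0)))// gerBl.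
  exact: exprn_ge0.
pose c K := mean (fun x => rho x * beta K x).
pose Del y := alpha y - alpha 0 - (U y - U 0).
have ci K n : continuous (fun x => beta K (iter n F x)).
  exact: (@comp_iter_lift_continuous _ F dF F_der n (beta K) (cbeta K)).
have key y K : 0 <= y <= 1 -> `|Del y - c K * y| <= (C1 + C1 + C2) * kap ^+ K.
  move=> /andP[y0 y1].
  pose P : set (measurableTypeR R) := `[0, y]%classic.
  have mP : measurable P by exact: measurable_itv.
  have mI : measurable (`[0, 1]%classic : set (measurableTypeR R)) by exact: measurable_itv.
  have subP : (`[0, y]%classic : set R) `<=` `[0, 1]%classic.
    by apply: subset_itvl; rewrite bnd_simp.
  have ih : (@lebesgue_measure R).-integrable `[0, 1] (EFin \o (\1_P : R -> R)).
    apply: (integrableS measurableT mI) => //; exact: integrable_indic_itv.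
  have := equidistribution_integrable gam_le1 rhoP (cbeta K) (pbeta K) ih.
  rewrite -/(c K).
  have ce n : continuous (fun x => beta K (iter n F x) - c K).
    by move=> x; apply: cvgB; [exact: ci|exact: cvg_cst].
  have -> : (fun n => \int[@lebesgue_measure R]_(x in `[0, 1])
      (\1_P x * (beta K (iter n F x) - c K))) =
      (fun n => segint 0 y (fun x => beta K (iter n F x)) - c K * y).
    apply/funext => n.
    have ecst : c K * y = segint 0 y (fun=> c K) by rewrite segint_cst// subr0.
    rewrite ecst -segintB//; last exact: cst_cont.
    rewrite /segint -[in RHS](setIidr subP) Rintegral_mkcondr.
    by apply: eq_Rintegral => x _; rewrite patch_indic /= mulrC.
  move=> hlim; apply/ler_addgt0Pr => e e0.
  have /cvgrPdist_le/(_ e e0)[n _ /(_ n (leqnn _))] := hlim.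
  rewrite /= sub0r normrN => hn.
  have e1 : segint 0 y (beta (K + n)%N) =
      (approx (K + n) y - approx (K + n) 0) - (U y - U 0).
    rewrite (segintB 0 y (@dapprox_continuous _) cu).
    by rewrite (segintE (@dapprox_continuous _) (approx_derive _) y0) (segintE cu dU y0).
  have e2 : `|segint 0 y (beta (K + n)%N) - segint 0 y (fun x => beta K (iter n F x))|
      <= C2 * kap ^+ K.
    rewrite -segintB//; apply: (@le_trans _ _ (C2 * kap ^+ K * (y - 0))).
      apply: segint_norm_le => //.
      by move=> x; apply: cvgB; [exact: cbeta|exact: ci].
    by rewrite subr0 (ler_piMr (mulr_ge0 C20 (exprn_ge0 K k0))).
  have hk : kap ^+ (K + n) <= kap ^+ K.
    by rewrite exprD ler_piMr ?exprn_ge0// exprn_ile1// ltW.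
  have h1 := le_trans (hC1 (K + n)%N y) (ler_wpM2l C10 hk).
  have h2 := le_trans (hC1 (K + n)%N 0) (ler_wpM2l C10 hk).
  have -> : Del y - c K * y =
    (alpha y - approx (K + n) y) - (alpha 0 - approx (K + n) 0) +
    ((segint 0 y (beta (K + n)%N) - segint 0 y (fun x => beta K (iter n F x))) +
     (segint 0 y (fun x => beta K (iter n F x)) - c K * y)).
    by rewrite e1 /Del; ring.
  have -> : (C1 + C1 + C2) * kap ^+ K + e =
    (C1 * kap ^+ K + C1 * kap ^+ K) + (C2 * kap ^+ K + e) by ring.
  apply: le_trans (ler_normD _ _) _; apply: lerD.
    by apply: le_trans (ler_normB _ _) _; exact: lerD.
  by apply: le_trans (ler_normD _ _) _; exact: lerD.
have lin y : 0 <= y <= 1 -> Del y = Del 1 * y.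
  move=> y01; have /andP[y0 y1] := y01.
  apply/eqP; rewrite -subr_eq0; apply/eqP.
  pose C3 := C1 + C1 + C2.
  apply: (@geometric_eq0 _ _ (C3 + C3) kap kap_itv) => K.
  have h1 := key y K y01; have h2 := key 1 K; rewrite ler01 lexx mulr1 in h2.
  have {}h2 := h2 isT.
  have -> : Del y - Del 1 * y = (Del y - c K * y) - (Del 1 - c K) * y by ring.
  apply: le_trans (ler_normB _ _) _; rewrite [leRHS]mulrDl; apply: lerD => //.
  by rewrite normrM -[leRHS]mulr1; apply: ler_pM => //; rewrite ger0_norm.
exists (Del 1) => x.
pose E x := Del x - Del 1 * x.
have pE : periodic E 1.
  move=> z; have := primitive_shift z 0 pu dU; rewrite add0r => hU.
  rewrite /E /Del weierstrass_per -[in alpha 1](add0r 1) weierstrass_per.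
  have -> : U (z + 1) = U 1 - U 0 + U z by rewrite -hU subrK.
  ring.
have : E x = 0.
  rewrite -(periodic_fracpart x pE) /E lin ?subrr//.
  by have /andP[-> /ltW] := fracpart_itv x.
by rewrite /E {1}/Del; lra.
Qed.

Lemma weierstrass_derive (u : R -> R) : continuous u -> periodic u 1 ->
    (forall x, phi x = u x - u (F x)) ->
  exists c, forall x, is_derive x 1 alpha (u x + c).
Proof.
move=> cu pu hu; have [U dU] := exists_primitive cu.
have [c hc] := weierstrass_primitive cu pu hu dU; exists c => x.
have -> : alpha = fun x => (alpha 0 + (U x - U 0)) + c * x by apply/funext.
apply: is_deriveD; last first.
  by rewrite -[X in is_derive _ _ _ X]mulr1; apply: (@is_deriveZ _ _ _ id).
rewrite -[X in is_derive _ _ _ X]add0r; apply: is_deriveD.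
by rewrite -[X in is_derive _ _ _ X]subr0; apply: is_deriveB.
Qed.

End invariant.
End weierstrass_function.

(** * The dichotomy *)

Lemma small_exponent {R : realType} (M lam eps : R) : 1 < lam -> lam <= M ->
  0 < eps -> exists gam, [/\ 0 < gam, gam <= eps & M `^ gam < lam].
Proof.
move=> l1 lM e0.
have l0 : 0 < lam by exact: lt_trans l1.
have M1 : 1 < M by exact: lt_le_trans lM.
have lnM : 0 < ln M by exact: ln_gt0.
have lnl : 0 < ln lam by exact: ln_gt0.
exists (Num.min eps (ln lam / ln M / 2)); split.
- by rewrite lt_min e0 !divr_gt0.
- by rewrite ge_min lexx.
set g := Num.min _ _.
have hg : g * ln M < ln lam.
  apply: (@le_lt_trans _ _ (ln lam / ln M / 2 * ln M)).
    by rewrite ler_wpM2r ?(ltW lnM)// /g ge_min lexx orbT.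
  have -> : ln lam / ln M / 2 * ln M = ln lam / 2 by field; rewrite gt_eqF.
  by rewrite ltr_pdivrMr//; lra.
have -> : M `^ g = expR (g * ln M) by rewrite /powR gt_eqF// (lt_trans _ M1).
by rewrite -[ltRHS](lnK (_ : lam \is Num.pos)) ?posrE// ltr_expR.
Qed.

Theorem theorem1p3 (R : realType) (eps : R) (F v : R -> R)
    (mu : probability (measurableTypeR R) R)
    (heps0 : 0 < eps) (heps1 : eps < 1)
    (hFlift : circle_lift F) (hFC : class_C_holder 2 eps F)
    (hFexp : expanding F)
    (hvper : periodic v 1) (hvC : class_C_holder 1 eps v)
    (hmu_circle : on_circle mu)
    (hmu_inv : circle_invariant F mu)
    (hmu_ac : mu `<< @lebesgue_measure R) :
  sigma F (weierstrass_phi F v) mu = 0%E <->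
  class_C_holder 1 eps (weierstrass F v).
Proof.
have [d F_lift] := hFlift.
have [lam lam_gt1 hlam] := hFexp.
have [derF ddF_cont ddF_hol] := hFC; have [derv dv_cont dv_hol] := hvC.
pose dF : R -> R := derive1 F; pose ddF : R -> R := derive1n 2 F.
pose dv : R -> R := derive1 v.
have F_der (x : R) : is_derive x 1 F (dF x) by apply: derive1_is_derive; exact: (derF 0%N).
have dF_der (x : R) : is_derive x 1 dF (ddF x) by apply: derive1_is_derive; exact: (derF 1%N).
have v_der (x : R) : is_derive x 1 v (dv x) by apply: derive1_is_derive; exact: (derv 0%N).
have dF_lam x : lam <= `|dF x| by exact: ltW (hlam x).
have dF_per : periodic dF 1 by exact: derive_periodic F_lift F_der.
have dF_per0 x : dF (x + 1) = dF x + 0 by rewrite addr0 dF_per.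
have v_per0 x : v (x + 1) = v x + 0 by rewrite addr0 hvper.
have ddF_per : periodic ddF 1 by exact: derive_periodic dF_per0 dF_der.
have dv_per : periodic dv 1 by exact: derive_periodic v_per0 v_der.
have l0 := lt_trans ltr01 lam_gt1.
have dF_neq0 x : dF x != 0 by rewrite -normr_gt0 (lt_le_trans l0).
have dF_cont : continuous dF by exact: is_derive_continuous dF_der.
have v_cont : continuous v by exact: is_derive_continuous v_der.
pose alpha : R -> R := weierstrass F v; pose phi : R -> R := weierstrass_phi F v.
have approx_cvg := weierstrass_approx F_der v_der lam_gt1 dF_lam hvper.
have alpha_per : periodic alpha 1.
  exact (weierstrass_per F_lift lam_gt1 dF_per hvper approx_cvg).
have alpha_eq x : alpha (F x) = v x + dF x * alpha x.
  exact (weierstrass_eq lam_gt1 dF_lam approx_cvg x).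
have phi_cont : continuous phi.
  exact (phi_continuous F_der dF_der v_der lam_gt1 dF_lam ddF_cont dv_cont approx_cvg).
have phi_perd : periodic phi 1.
  exact (phi_per F_lift lam_gt1 dF_per ddF_per hvper dv_per approx_cvg).
split=> [sig0|[deralpha dalpha_cont _]]; last first.
  (* differentiating the equation of alpha gives phi = alpha' - alpha' o F *)
  pose u : R -> R := derive1 alpha.
  have u_der (x : R) : is_derive x 1 alpha (u x) by apply: derive1_is_derive; exact: (deralpha 0%N).
  have alpha_per0 x : alpha (x + 1) = alpha x + 0 by rewrite addr0 alpha_per.
  have u_per : periodic u 1 by exact: derive_periodic alpha_per0 u_der.
  have u_bd : bounded_fct u by exact: (periodic_bounded dalpha_cont u_per).
  apply: (coboundary_zero_variance mu F_der phi_cont phi_perd u_bd) => x.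
  have h1 := is_derive1_comp (u_der (F x)) (F_der x).
  have h2 := is_deriveD (v_der x) (is_deriveM (dF_der x) (u_der x)).
  have e : alpha \o F = v + dF * alpha by apply/funext => y; exact: alpha_eq.
  have : u (F x) * dF x = dv x + (dF x * u x + alpha x * ddF x).
    by rewrite -(is_derive_derive1 h1) e (is_derive_derive1 h2).
  rewrite /phi /weierstrass_phi -/alpha -/dv -/dF -/ddF -/u.
  move: (u (F x)) (u x) (alpha x) (dF_neq0 x) => uF ux ax nz hu.
  have -> : uF = (dv x + (dF x * ux + ax * ddF x)) / dF x by rewrite -hu mulfK.
  by field.
have main gam : 0 < gam -> gam <= 1 -> bholder gam dF -> bholder gam phi ->
    exists u c, bholder gam u /\ forall x : R, is_derive x 1 alpha (u x + c).
  move=> g0 g1 bdF bphi.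
  have [rho rhoP] := exists_invariant_density F_lift F_der lam_gt1 dF_lam g0 bdF.
  have m0 := mean_phi0 dF_der v_der dF_per ddF_per ddF_cont hvper dv_per
    dv_cont approx_cvg rhoP.
  have [w [bw pw hw]] := zero_variance_coboundary g1 hmu_circle hmu_inv hmu_ac
    rhoP bphi phi_perd m0 sig0.
  have bu := bholderN bw.
  have cu : continuous (fun x => - w x) by exact: holder_cont g0 _ bu.2.
  have pu : periodic (fun x => - w x) 1 by move=> x; rewrite pw.
  have hu x : phi x = - w x - - w (F x) by rewrite hw opprK addrC.
  have [c hc] := weierstrass_derive dF_der v_der dF_per ddF_per ddF_cont hvper
    dv_per dv_cont approx_cvg g1 rhoP cu pu hu.
  by exists (fun x => - w x), c.
have bd_ddF := periodic_bounded ddF_cont ddF_per.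
have bd_dv := periodic_bounded dv_cont dv_per.
have bd_dF := periodic_bounded dF_cont dF_per.
have e1 : eps <= 1 by exact: ltW.
have bddF : bholder eps ddF by [].
have bdv : bholder eps dv by [].
have bdF : bholder eps dF.
  have [B hB] := bd_ddF.
  exact: (bholder_lipschitz heps0 e1 bd_dF (lipschitz_of_derive dF_der hB)).
have bv : bholder eps v.
  have [B hB] := bd_dv.
  exact: (bholder_lipschitz heps0 e1 (periodic_bounded v_cont hvper)
    (lipschitz_of_derive v_der hB)).
have phiH gam : 0 < gam -> gam <= eps -> bholder gam alpha -> bholder gam phi.
  move=> g0 ge ba; have wk f := @bholder_weaken _ _ _ f g0 ge.
  apply: bholderN; apply: bholderM; last by apply: (bholderV l0 dF_lam); exact: wk.
  by apply: bholderD; [exact: wk|apply: bholderM => //; exact: wk].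
have [M hM] := bd_dF.
have lamM : lam <= M by exact: le_trans (dF_lam 0) (hM 0).
(* A small exponent gives a first derivative of alpha; it makes alpha Lipschitz,
   hence phi eps-Hoelder, and the argument is repeated with the exponent eps. *)
have [gam [g0 ge hgam]] := small_exponent lam_gt1 lamM heps0.
have ba0 : bholder gam alpha.
  apply: (weierstrass_bholder v_der lam_gt1 dF_lam hvper approx_cvg g0
    (bholder_weaken g0 ge bv) (bholder_weaken g0 ge bdF) _
    (lipschitz_of_derive F_der hM) hgam).
  exact: le_trans (ltW l0) lamM.
have [u0 [c0 [bu0 du0]]] := main gam g0 (le_trans ge e1) (bholder_weaken g0 ge bdF)
  (phiH gam g0 ge ba0).
have ba : bholder eps alpha.
  have [B hB] := bu0.1.
  have hB1 x : `|u0 x + c0| <= B + `|c0| by apply: le_trans (ler_normD _ _) _; rewrite lerD2r.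
  exact: (bholder_lipschitz heps0 e1 ba0.1 (lipschitz_of_derive du0 hB1)).
have [u [c [bu du]]] := main eps heps0 e1 bdF (phiH eps heps0 (lexx _) ba).
have eu : derive1n 1 alpha = fun x => u x + c.
  by apply/funext => x; exact: is_derive_derive1.
have buc : bholder eps (fun x => u x + c) by apply: bholderD => //; exact: bholder_cst.
split.
- by move=> [|//] x _; have [] := du x.
- by rewrite eu; exact: holder_cont heps0 _ buc.2.
- by rewrite eu; exact: buc.2.
Qed.
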